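(* Let $\xi$ be a real-valued random variable with zero mean and finite positive variance, and assume that the moment generating function $M_\xi(t)=\mathbb{E}(e^{t\xi})$ exists (is finite) in an open interval around zero. Let $\{\xi_k : k\ge 0\}$ be a sequence of independent identically distributed random variables with $\xi_k$ equal in distribution to $\xi$ for every $k\ge 0$. Let $\mathcal{C}_n:=\mathrm{circ}(\xi_0,\ldots,\xi_{n-1})$ be the corresponding $n\times n$ random circulant matrix and let $s_n(\mathcal{C}_n)$ be its smallest singular value. Then, for all fixed $t\ge 1$ and $\gamma>1/2$, $$\mathbb{P}\left(s_n(\mathcal{C}_n)\le t\,n^{-1/2}(\log n)^{-\gamma}\right)=O\big((\log n)^{-\gamma+1/2}\big)\qquad (n\to\infty).$$
   Context: For $c_0,\ldots,c_{n-1}\in\mathbb{C}$, $\mathrm{circ}(c_0,\ldots,c_{n-1})$ is the $n\times n$ circulant matrix with first row $(c_0,c_1,\ldots,c_{n-1})$ in which each subsequent row is the cyclic shift of the previous row by one position to the right; i.e. its $(j,k)$ entry, $0\le j,k\le n-1$, is $c_{(k-j)\bmod n}$. *)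

(* Defs.v *)
From HB Require Import structures.
From mathcomp Require Import all_boot all_order all_algebra.
From mathcomp Require Import finmap.
From mathcomp Require Import all_classical all_reals all_analysis.
From mathcomp Require Import complex.

Set Implicit Arguments.
Unset Strict Implicit.
Unset Printing Implicit Defensive.

Import Order.TTheory GRing.Theory Num.Theory.
Import numFieldNormedType.Exports.

Local Open Scope classical_set_scope.
Local Open Scope ring_scope.
Local Open Scope complex_scope.
Local Open Scope sesquilinear_scope.

(* [circ n c] only depends on [c 0, ..., c n.-1]; writing k + (n - j) instead
   of k - j avoids truncated subtraction. *)
Definition circ (V : Type) (n : nat) (c : nat -> V) : 'M[V]_n :=
  \matrix_(j < n, k < n) c ((k + (n - j)) %% n)%N.

(* The singular values of A are the nonnegative square roots of the eigenvalues
   of A^* A, where A^* is the conjugate transpose. *)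
Definition singular_value (R : realType) (n : nat) (A : 'M[R[i]]_n) (s : R) :
  Prop := 0 <= s /\ eigenvalue (A ^t* *m A) (s ^+ 2)%:C.

(* For 0 < n the set of singular values is finite and nonempty, so that the
   infimum is a minimum; for n = 0 the value is 0 by convention. *)
Definition smallest_singular_value (R : realType) (n : nat) (A : 'M[R[i]]_n) :
  R := inf [set s | singular_value A s].

Section random_variables.
Context (R : realType) (d : measure_display) (T : measurableType d)
        (P : probability T R).

Definition mutually_independent (I : choiceType) (X : I -> {RV P >-> R}) :
  Prop :=
  forall (J : {fset I}) (B : I -> set R),
    (forall k, k \in J -> measurable (B k)) ->
    P (\bigcap_(k in [set` J]) (X k @^-1` B k)) =
    (\prod_(k <- J) P (X k @^-1` B k))%E.

(* The two variables may live on different probability spaces. *)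
Definition equal_in_distribution (d' : measure_display) (T' : measurableType d')
    (P' : probability T' R) (X : {RV P >-> R}) (Y : {RV P' >-> R}) : Prop :=
  forall B : set R, measurable B -> distribution P X B = distribution P' Y B.

Definition mgf_finite_near0 (X : {RV P >-> R}) : Prop :=
  exists2 h : R, 0 < h & forall t : R, `|t| < h -> ('M_P X t < +oo)%E.

End random_variables.

(* Main.v *)
Require Import Defs.
From mathcomp Require Import all_boot all_order all_algebra.
From mathcomp Require Import finmap.
From mathcomp Require Import all_classical all_reals all_analysis.
From mathcomp Require Import measurable_realfun complex.
From mathcomp Require Import ring lra.

Set Implicit Arguments.
Unset Strict Implicit.
Unset Printing Implicit Defensive.

Import Order.TTheory GRing.Theory Num.Theory.
Import numFieldNormedType.Exports.

Local Open Scope classical_set_scope.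
Local Open Scope ring_scope.
Local Open Scope complex_scope.

(** The singular values of the circulant matrix are the moduli of the sums
[lambda_k = \sum_(l < n) xi_l exp (2 i pi k l / n)], so the event is a union over
[k < n] of small ball events for [lambda_k]. A discrete Esseen inequality bounds
each of them by averages of [E cos (a Re lambda_k + b Im lambda_k)], which
independence bounds by [exp (- H / 2)], where [H] is the mean over the
symmetrization [D] of [xi] of the energy [\sum_(l < n) (1 - cos (D y_l))],
[y_l = a cos (2 pi k l / n) + b sin (2 pi k l / n)]. The energy is quadratic in
the amplitude when that is at most 1. When the amplitude is larger, but small
against the order of [exp (2 i pi k / n)], replacing [y] by a suitable difference
[y_(l + m) - y_l], of amplitude of order 1, shows that the energy is of order [n].
With [q] the integer part of [n^(1/16)], this gives a bound of order [q^(-18)]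
for the frequencies of order larger than [q^2], and of order [q^(-7)] for the
[O(q^4)] remaining ones: a total of order [q^(-2)], smaller than any
negative power of [ln n]. *)

(** * Trigonometric inequalities *)

Section trigonometry.
Context {R : realType}.
Implicit Types x y v rho : R.

Lemma sin_MVT x : 0 <= x -> exists2 y, 0 <= y <= x & sin x = x * cos y.
Proof.
move=> x0; have [|y] := @MVT_segment R sin cos 0 x x0.
  by apply: continuous_subspaceT; exact: continuous_sin.
rewrite in_itv/= sin0 !subr0 => yx ->; exists y => //.
by rewrite mulrC.
Qed.

Lemma sqr_sin_le x : sin x ^+ 2 <= x ^+ 2.
Proof.
wlog x0 : x / 0 <= x.
  move=> H; have [/H//|/ltW x0] := lerP 0 x.
  by have := H (- x); rewrite sinN !sqrrN; apply; rewrite oppr_ge0.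
have [y _ ->] := sin_MVT x0.
by rewrite exprMn ler_piMr ?sqr_ge0// cos2sin2 gerBl sqr_ge0.
Qed.

Lemma oneBcos x : 1 - cos x = 2 * sin (x / 2) ^+ 2.
Proof.
have {1}-> : x = (x / 2) *+ 2 by rewrite mulr2n; field.
rewrite cos_mulr2n cos2sin2 mulr2n; ring.
Qed.

Lemma oneBcos_le x : 1 - cos x <= x ^+ 2 / 2.
Proof. by rewrite oneBcos; have := sqr_sin_le (x / 2); nra. Qed.

Lemma oneBcos_ge0 x : 0 <= 1 - cos x.
Proof. by rewrite subr_ge0 cos_le1. Qed.

Lemma oneBcos_ge x : `|x| <= 1 -> x ^+ 2 / 4 <= 1 - cos x.
Proof.
wlog x0 : x / 0 <= x.
  move=> H; have [/H//|/ltW x0 x1] := lerP 0 x.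
  have := H (- x); rewrite cosN sqrrN normrN; apply => //.
  by rewrite oppr_ge0.
rewrite ger0_norm// => x1; rewrite oneBcos.
have x20 : 0 <= x / 2 by rewrite divr_ge0.
have [y /andP[y0 yx] ->] := sin_MVT x20.
(* Here [y] is at most 1/2, and [1 - y^2 / 2] is then at least 7/8. Its square 49/64 exceeds the 1/2
   that the claim requires. *)
have cy : 7 / 8 <= cos y by have := oneBcos_le y; nra.
have : 49 / 64 <= cos y ^+ 2 by nra.
rewrite exprMn; have := sqr_ge0 (x / 2); nra.
Qed.

Lemma cos_lt1 x : 0 < x < pi *+ 2 -> cos x < 1.
Proof.
move=> /andP[x0 x2]; rewrite -subr_gt0 oneBcos mulr_gt0// exprn_gt0//.
apply: sin_gt0_pi; rewrite divr_gt0//= ltr_pdivrMr//.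
by rewrite mulr_natr.
Qed.

Lemma pi_lt4 : pi < 4 :> R.
Proof. have := @pihalf_lt2 R; lra. Qed.

(** Since [2 (1 - cos x)] is the squared length of the chord from 1 to [exp (i x)], this is the
    triangle inequality combined with [(u + v)^2 <= 2 u^2 + 2 v^2]. It compares the energy of a
    difference of two waves with the energies of the waves. *)
Lemma oneBcosB_le x y : 1 - cos (x - y) <= 2 * (1 - cos x) + 2 * (1 - cos y).
Proof.
rewrite cosB; have := cos2Dsin2 x; have := cos2Dsin2 y.
have := sqr_ge0 (cos x + cos y - 2); have := sqr_ge0 (sin x + sin y).
nra.
Qed.

End trigonometry.
(** * Cosine energies along an arithmetic progression of angles *)

Section cyclic_sums.
Context {R : realType}.
Implicit Types (a b v : R) (f : nat -> R).

Lemma sum_periodic_shift f n m : (forall j, f (j + n)%N = f j) ->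
  \sum_(j < n) f (j + m)%N = \sum_(j < n) f j.
Proof.
move=> fn; elim: m => [|m <-]; first by apply: eq_bigr => j _; rewrite addn0.
have : \sum_(j < n.+1) f (j + m)%N = \sum_(j < n.+1) f (j + m)%N by [].
rewrite {1}big_ord_recl big_ord_recr/= add0n addnC fn [in RHS]addrC => /addrI.
by move=> <-; apply: eq_bigr => j _; rewrite /bump/= add1n addnS.
Qed.

Definition wave a b v (j : nat) : R := a * cos (j%:R * v) + b * sin (j%:R * v).

Definition energy a b v (n : nat) : R := \sum_(j < n) (1 - cos (wave a b v j)).

Lemma cosD_nat v j m : cos ((j + m)%:R * v) =
  cos (j%:R * v) * cos (m%:R * v) - sin (j%:R * v) * sin (m%:R * v).
Proof. by rewrite natrD mulrDl cosD. Qed.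

Lemma sinD_nat v j m : sin ((j + m)%:R * v) =
  sin (j%:R * v) * cos (m%:R * v) + cos (j%:R * v) * sin (m%:R * v).
Proof. by rewrite natrD mulrDl sinD. Qed.

Lemma cosn_eq1 v j : cos v = 1 -> cos (j%:R * v) = 1.
Proof.
move=> v1; have s0 : sin v = 0 by apply: cos1sin0; rewrite v1 normr1.
suff [] : cos (j%:R * v) = 1 /\ sin (j%:R * v) = 0 by [].
elim: j => [|j [Hc Hs]]; first by rewrite mul0r cos0 sin0.
by rewrite -addn1 cosD_nat sinD_nat Hc Hs !mul1r v1 s0 !mulr0 mul0r subr0 addr0.
Qed.

Section periodic_angle.
Context (n : nat) (v : R).
Hypotheses (cosnv : cos (n%:R * v) = 1) (sinnv : sin (n%:R * v) = 0).

Lemma cos_period j : cos ((j + n)%:R * v) = cos (j%:R * v).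
Proof. by rewrite cosD_nat cosnv sinnv mulr1 mulr0 subr0. Qed.

Lemma sin_period j : sin ((j + n)%:R * v) = sin (j%:R * v).
Proof. by rewrite sinD_nat cosnv sinnv mulr1 mulr0 addr0. Qed.

(** Shifting the index by one multiplies [C + i S] by [exp (i v)] and leaves it unchanged. In real
    terms this is a linear system in [C] and [S] whose determinant is the squared modulus of
    [1 - exp (i v)]. *)
Lemma sum_cos_sin_eq0 : cos v != 1 ->
  \sum_(j < n) cos (j%:R * v) = 0 /\ \sum_(j < n) sin (j%:R * v) = 0.
Proof.
set C := \sum_(j < n) _; set S := \sum_(j < n) _ => v1.
have CE : C = C * cos v - S * sin v.
  rewrite {1}/C -(@sum_periodic_shift (fun j => cos (j%:R * v)) n 1 cos_period).
  rewrite !mulr_suml -sumrB; apply: eq_bigr => j _.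
  by rewrite cosD_nat mul1r.
have SE : S = S * cos v + C * sin v.
  rewrite {1}/S -(@sum_periodic_shift (fun j => sin (j%:R * v)) n 1 sin_period).
  rewrite !mulr_suml -big_split; apply: eq_bigr => j _ /=.
  by rewrite sinD_nat mul1r.
have v10 : 1 - cos v != 0 by rewrite subr_eq0 eq_sym.
have N0 : (1 - cos v) ^+ 2 + sin v ^+ 2 != 0.
  by rewrite paddr_eq0 ?sqr_ge0// sqrf_eq0 (negbTE v10).
have C0 : C * ((1 - cos v) ^+ 2 + sin v ^+ 2) = 0.
  have : (1 - cos v) * (C - (C * cos v - S * sin v)) = 0 by rewrite -CE subrr mulr0.
  have : sin v * (S - (S * cos v + C * sin v)) = 0 by rewrite -SE subrr mulr0.
  lra.
have S0 : S * ((1 - cos v) ^+ 2 + sin v ^+ 2) = 0.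
  have : sin v * (C - (C * cos v - S * sin v)) = 0 by rewrite -CE subrr mulr0.
  have : (1 - cos v) * (S - (S * cos v + C * sin v)) = 0 by rewrite -SE subrr mulr0.
  lra.
split; [move: C0|move: S0]; move=> /eqP; rewrite mulf_eq0 (negbTE N0) orbF.
  by move/eqP.
by move/eqP.
Qed.


End periodic_angle.

Section wave_energy.
Context (n : nat) (v : R).
Hypotheses (cosnv : cos (n%:R * v) = 1) (sinnv : sin (n%:R * v) = 0).

Let cosn2v : cos (n%:R * (v *+ 2)) = 1.
Proof. by rewrite mulrnAr cos_mulr2n cosnv expr1n mulr2n addrK. Qed.

Let sinn2v : sin (n%:R * (v *+ 2)) = 0.
Proof. by rewrite mulrnAr sin_mulr2n sinnv mulr0 mul0rn. Qed.

(** The squared wave is its mean plus a wave of the doubled angle, and the latter sums to zero over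
    a full period. *)
Lemma sum_sqr_wave a b : cos (v *+ 2) != 1 ->
  \sum_(j < n) wave a b v j ^+ 2 = n%:R * ((a ^+ 2 + b ^+ 2) / 2).
Proof.
move=> v2; have [C0 S0] := sum_cos_sin_eq0 cosn2v sinn2v v2.
transitivity (\sum_(j < n) ((a ^+ 2 + b ^+ 2) / 2
    + (a ^+ 2 - b ^+ 2) / 2 * cos (j%:R * (v *+ 2))
    + a * b * sin (j%:R * (v *+ 2)))).
  apply: eq_bigr => j _; rewrite /wave !mulrnAr cos_mulr2n sin_mulr2n.
  set x := j%:R * v; have := cos2Dsin2 x => h.
  have -> : cos x ^+ 2 *+ 2 - 1 = cos x ^+ 2 - sin x ^+ 2 by lra.
  rewrite -[(a ^+ 2 + b ^+ 2) / 2]mulr1 -[X in _ * X + _ + _]h; by field.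
rewrite !big_split/= -!mulr_sumr C0 S0 !mulr0 !addr0.
by rewrite sumr_const card_ord -[_ *+ n]mulr_natl; ring.
Qed.

Lemma wave_le a b j : wave a b v j ^+ 2 <= a ^+ 2 + b ^+ 2.
Proof.
rewrite /wave; set x := _ * v; have := cos2Dsin2 x.
have := sqr_ge0 (a * sin x - b * cos x); nra.
Qed.

Lemma energy_ge_small a b : cos (v *+ 2) != 1 -> a ^+ 2 + b ^+ 2 <= 1 ->
  n%:R * ((a ^+ 2 + b ^+ 2) / 8) <= energy a b v n.
Proof.
move=> v2 ab1; have -> : n%:R * ((a ^+ 2 + b ^+ 2) / 8) =
    \sum_(j < n) wave a b v j ^+ 2 / 4.
  by rewrite -mulr_suml sum_sqr_wave//; field.
apply: ler_sum => j _; apply: oneBcos_ge.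
by rewrite -(@expr_le1 _ 2)// real_normK ?num_real// (le_trans (wave_le _ _ _)).
Qed.

Lemma energy_ge_cos a : a ^+ 2 <= 1 -> n%:R * (a ^+ 2 / 8) <= energy a 0 v n.
Proof.
move=> a1; have C0 : 0 <= \sum_(j < n) cos (j%:R * (v *+ 2)).
  have [v2|v2] := eqVneq (cos (v *+ 2)) 1; last first.
    by have [-> _] := sum_cos_sin_eq0 cosn2v sinn2v v2.
  by apply: sumr_ge0 => j _; rewrite cosn_eq1.
apply: (@le_trans _ _ (\sum_(j < n) wave a 0 v j ^+ 2 / 4)).
  have -> : \sum_(j < n) wave a 0 v j ^+ 2 / 4 =
      n%:R * (a ^+ 2 / 8) + a ^+ 2 / 8 * \sum_(j < n) cos (j%:R * (v *+ 2)).
    rewrite mulr_sumr.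
    transitivity (\sum_(j < n) (a ^+ 2 / 8 + a ^+ 2 / 8 * cos (j%:R * (v *+ 2)))).
      apply: eq_bigr => j _; rewrite /wave mulrnAr cos_mulr2n; by field.
    by rewrite big_split/= sumr_const card_ord mulr_natl.
  by rewrite lerDl mulr_ge0// divr_ge0// sqr_ge0.
apply: ler_sum => j _; apply: oneBcos_ge.
rewrite -(@expr_le1 _ 2)// real_normK ?num_real// (le_trans (wave_le _ _ _))//.
by rewrite expr0n addr0.
Qed.

Lemma wave_shift a b m j : wave a b v (j + m) - wave a b v j =
  wave (a * (cos (m%:R * v) - 1) + b * sin (m%:R * v))
       (b * (cos (m%:R * v) - 1) - a * sin (m%:R * v)) v j.
Proof. by rewrite /wave cosD_nat sinD_nat; ring. Qed.

(** By [wave_shift] the left-hand side is the energy of a difference between the wave and its shift.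
    By periodicity both have the same energy, and [oneBcosB_le] counts each of them twice. *)
Lemma energy_shift_le a b m :
  energy (a * (cos (m%:R * v) - 1) + b * sin (m%:R * v))
       (b * (cos (m%:R * v) - 1) - a * sin (m%:R * v)) v n <= 4 * energy a b v n.
Proof.
rewrite /energy; under eq_bigr do rewrite -wave_shift.
apply: (@le_trans _ _ (\sum_(j < n) (2 * (1 - cos (wave a b v (j + m)))
    + 2 * (1 - cos (wave a b v j))))).
  by apply: ler_sum => j _; exact: oneBcosB_le.
rewrite big_split/= -!mulr_sumr.
rewrite (@sum_periodic_shift (fun j => 1 - cos (wave a b v j)) n m); first lra.
by move=> j; rewrite /wave cos_period// sin_period.
Qed.

(* Doubling [m] multiplies the squared amplitude [2 (1 - cos (m v)) r] of the
   shifted wave by a factor between 3 and 4 as long as it is at most 1/4, so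
   iterated doubling lands in the window [1/4, 1]. *)
Lemma exists_shift (r : R) m0 : 1 <= r -> 0 < 2 * (1 - cos (m0%:R * v)) * r <= 1 ->
  exists m, 1 / 4 <= 2 * (1 - cos (m%:R * v)) * r <= 1.
Proof.
move=> r1 f0; apply: contrapT => /forallNP H.
set f := fun m : nat => 2 * (1 - cos (m%:R * v)) * r.
(* If no multiple lands in the window, the doublings stay below 1/4 although each of them at least
   triples the value. Linear growth in [i] already contradicts the Archimedean property. *)
have K i : (i%:R + 1) * f m0 <= f (2 ^ i * m0)%N <= 1 / 4.
  elim: i => [|i IH].
    rewrite expn0 mul1n add0r mul1r lexx /=; have := H m0.
    by move: f0 => /andP[_ f1] Hm; rewrite leNgt; apply/negP => h; apply: Hm;
      rewrite f1 andbT ltW.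
  have f00 : 0 < f m0 by case/andP: f0.
  have := IH; set m := (2 ^ i * m0)%N => /andP[IH1 IH2].
  have -> : (2 ^ i.+1 * m0)%N = (m * 2)%N by rewrite expnSr mulnAC.
  have E : f (m * 2)%N = f m * (2 * (1 + cos (m%:R * v))).
    rewrite /f.
    have -> : (m * 2)%:R * v = (m%:R * v) *+ 2 by rewrite natrM mulr2n; ring.
    rewrite cos_mulr2n mulr2n; ring.
  (* As [r] is at least 1, a value at most 1/4 forces [1 - cos (m v) <= 1/8]. The doubling factor
     [2 (1 + cos (m v))] then lies between 15/4 and 4. *)
  have c8 : 7 / 8 <= cos (m%:R * v).
    have := oneBcos_ge0 (m%:R * v); move: IH2; rewrite /f; nra.
  have c1 := cos_le1 (m%:R * v).
  have i0 : (0 : R) <= i%:R by [].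
  have lo : 3 * f m <= f (m * 2)%N.
    rewrite E; have : 0 <= f m by apply: le_trans IH1; rewrite mulr_ge0 ?addr_ge0// ltW.
    nra.
  have hi : f (m * 2)%N <= 1.
    rewrite E; have : 0 <= f m by apply: le_trans IH1; rewrite mulr_ge0 ?addr_ge0// ltW.
    nra.
  apply/andP; split.
    rewrite -natr1; nra.
  by rewrite leNgt; apply/negP => h; apply: (H (m * 2)%N); rewrite hi andbT ltW.
have f00 : 0 < f m0 by case/andP: f0.
have := archi_boundP (ltW (divr_gt0 ltr01 f00)).
set N := Num.Def.archi_bound _; rewrite ltr_pdivrMr// => h.
by have /andP[] := K N; rewrite mulrDl mul1r; lra.
Qed.

(** Up to squared amplitude 1 this is [energy_ge_small]. Beyond, a shifted difference of squared
    amplitude in [[1/4, 1]] has energy at least [n / 32], which is at most four times the energy of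
    the wave; hence [n / 128]. *)
Lemma energy_ge a b m0 : cos (v *+ 2) != 1 ->
  0 < 1 - cos (m0%:R * v) -> 2 * (1 - cos (m0%:R * v)) * (a ^+ 2 + b ^+ 2) <= 1 ->
  n%:R * Num.min ((a ^+ 2 + b ^+ 2) / 8) (1 / 128) <= energy a b v n.
Proof.
move=> v2 m00 m01; set r := a ^+ 2 + b ^+ 2 in m01 *.
have [r1|/ltW r1] := lerP r 1.
  apply: le_trans (energy_ge_small v2 r1).
  by rewrite ler_wpM2l// ge_min lexx.
have [|m /andP[m1 m2]] := @exists_shift r m0 r1.
  by rewrite m01 andbT !mulr_gt0// (lt_le_trans ltr01).
have E : (a * (cos (m%:R * v) - 1) + b * sin (m%:R * v)) ^+ 2 +
    (b * (cos (m%:R * v) - 1) - a * sin (m%:R * v)) ^+ 2 =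
    2 * (1 - cos (m%:R * v)) * r.
  rewrite /r; have h := cos2Dsin2 (m%:R * v).
  transitivity ((a ^+ 2 + b ^+ 2) * (cos (m%:R * v) ^+ 2 + sin (m%:R * v) ^+ 2
    + 1 - 2 * cos (m%:R * v))); first by ring.
  by rewrite h; ring.
have := energy_ge_small v2 (a := (a * (cos (m%:R * v) - 1) + b * sin (m%:R * v)))
   (b := (b * (cos (m%:R * v) - 1) - a * sin (m%:R * v))).
rewrite E => /(_ m2) h.
have := le_trans h (energy_shift_le a b m).
have n0 : (0 : R) <= n%:R by [].
have : n%:R * Num.min (r / 8) (1 / 128) <= n%:R * (1 / 128).
  by rewrite ler_wpM2l// ge_min lexx orbT.
nra.
Qed.

End wave_energy.
End cyclic_sums.

(** * Fourier frequencies and the orders of the corresponding roots of unity *)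

Section frequencies.
Context {R : realType}.

Definition freq (n k : nat) : R := pi *+ 2 * (k%:R / n%:R).

Lemma cos_2pi_nat (m : nat) (x : R) : cos (x + pi *+ 2 * m%:R) = cos x.
Proof. by rewrite mulr_natr (periodicn (@cosD2pi R)). Qed.

Lemma sin_2pi_nat (m : nat) (x : R) : sin (x + pi *+ 2 * m%:R) = sin x.
Proof. by rewrite mulr_natr (periodicn (@sinD2pi R)). Qed.

Lemma freqn n k : (0 < n)%N -> n%:R * freq n k = pi *+ 2 * k%:R.
Proof. by move=> n0; rewrite /freq; field; rewrite pnatr_eq0 -lt0n. Qed.

Lemma cos_freqn n k : (0 < n)%N -> cos (n%:R * freq n k) = 1.
Proof. by move=> n0; rewrite freqn// -[X in cos X]add0r cos_2pi_nat cos0. Qed.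

Lemma sin_freqn n k : (0 < n)%N -> sin (n%:R * freq n k) = 0.
Proof. by move=> n0; rewrite freqn// -[X in sin X]add0r sin_2pi_nat sin0. Qed.

(* [freq_order n k] is the order of [exp (2 i pi k / n)]. *)
Definition freq_order (n k : nat) := (n %/ gcdn k n)%N.

(** Bezout's identity [u k = w n + gcd k n] shows that [u k / n] equals the inverse of the order up
    to the integer [w]. *)
Lemma exists_freq_mul n k : (0 < n)%N -> (0 < k)%N ->
  exists m : nat, forall j : nat,
    cos (j%:R * (m%:R * freq n k)) = cos (j%:R * (pi *+ 2 / (freq_order n k)%:R)).
Proof.
move=> n0 k0; case: (egcdnP n k0) => u w Euw _; exists u => j.
have g0 : (0 < gcdn k n)%N by rewrite gcdn_gt0 k0.
have En : n = (freq_order n k * gcdn k n)%N by rewrite divnK// dvdn_gcdr.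
have d0 : (0 < freq_order n k)%N by rewrite divn_gt0// dvdn_leq// dvdn_gcdr.
rewrite -[RHS](cos_2pi_nat (j * w)); congr cos.
have E : u%:R * k%:R = w%:R * n%:R + (gcdn k n)%:R :> R.
  by rewrite -natrM Euw natrD natrM.
have nR : n%:R = (freq_order n k)%:R * (gcdn k n)%:R :> R by rewrite {1}En natrM.
rewrite /freq; have -> : j%:R * (u%:R * (pi *+ 2 * (k%:R / n%:R))) =
   j%:R * (pi *+ 2) * (u%:R * k%:R) / n%:R :> R by ring.
rewrite E nR natrM; field.
by rewrite !pnatr_eq0 -!lt0n d0 g0.
Qed.

(** Some multiple of the angle is [2 pi / d] modulo [2 pi] and sign, where [d] is the order. If the
    doubled angle were trivial, so would be [4 pi / d], which is impossible for [d > 2]. The 32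
    comes from [x^2 / 2] at [x = 2 pi / d], with [pi < 4]. *)
Lemma freq_good n k : (0 < n)%N -> (2 < freq_order n k)%N ->
  cos (freq n k *+ 2) != 1 /\
  exists m : nat, 0 < 1 - cos (m%:R * freq n k) <= 32 / (freq_order n k)%:R ^+ 2.
Proof.
move=> n0 d2; have k0 : (0 < k)%N.
  by rewrite lt0n; apply: contraTN d2 => /eqP->; rewrite /freq_order gcd0n divnn n0.
have [m Hm] := exists_freq_mul n0 k0; set d := freq_order n k in d2 Hm *.
have d2R : 2 < d%:R :> R by rewrite ltr_nat.
have d0 : 0 < d%:R :> R by lra.
have pi0 := @pi_gt0 R; have pi4 := @pi_lt4 R.
split.
  apply/eqP => v1; have := @cosn_eq1 R _ m v1.
  have -> : m%:R * (freq n k *+ 2) = 2%:R * (m%:R * freq n k).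
    by rewrite mulr2n; ring.
  rewrite Hm => /eqP; apply/negP; rewrite lt_eqF// cos_lt1// mulrA divr_gt0//=; last first.
    by rewrite mulr2n; nra.
  rewrite ltr_pdivrMr// mulr2n; nra.
exists m; have := Hm 1%N; rewrite !mul1r => ->; rewrite subr_gt0 cos_lt1/=; last first.
  rewrite divr_gt0 ?ltr_pdivrMr// ?mulr2n; nra.
apply: le_trans (oneBcos_le _) _; rewrite expr_div_n mulrAC ler_pM2r ?invr_gt0 ?exprn_gt0//.
rewrite mulr2n; nra.
Qed.

(** An index [k] is determined by the fraction [k / n] in lowest terms. The denominator of that
    fraction is the order, and its numerator is no larger because [k < n]. *)
Lemma card_freq_bad n D :
  (#|[set k : 'I_n | (freq_order n k <= D)%N]%SET| <= D.+1 ^ 2)%N.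
Proof.
pose f (k : 'I_n) : 'I_D.+1 * 'I_D.+1 :=
  (inord (k %/ gcdn k n), inord (freq_order n k)).
have n0 (k : 'I_n) : (0 < n)%N by apply: leq_ltn_trans (ltn_ord k).
rewrite -(@card_in_imset _ _ f).
  by rewrite (leq_trans (max_card _))// card_prod card_ord.
move=> k l; rewrite !inE => kD lD [].
have H (i : 'I_n) : (freq_order n i <= D)%N -> (i %/ gcdn i n < D.+1)%N.
  move=> iD; rewrite ltnS (leq_trans _ iD)// leq_div2r// ltnW//.
move=> /(congr1 val); rewrite /= !inordK ?H// => E1.
move=> /(congr1 val); rewrite /= !inordK ?ltnS// => E2.
have E3 : gcdn k n = gcdn l n.
  have Ek : (freq_order n k * gcdn k n = n)%N by rewrite divnK// dvdn_gcdr.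
  have El : (freq_order n l * gcdn l n = n)%N by rewrite divnK// dvdn_gcdr.
  apply/eqP; rewrite -(@eqn_pmul2l (freq_order n k)).
    by rewrite Ek E2 El.
  by rewrite lt0n; apply/eqP => h; have := n0 k; rewrite -Ek h.
apply/val_inj => /=; rewrite -(divnK (dvdn_gcdl k n)) E1 E3 divnK//.
by rewrite dvdn_gcdl.
Qed.

End frequencies.
(** * Singular values of circulant matrices *)

Section circulant_singular_values.
Context {R : realType}.
Local Open Scope sesquilinear_scope.
Implicit Types (x : R) (z : R[i]) (c : nat -> R).

Definition cis x : R[i] := cos x +i* sin x.

Lemma cisD x y : cis (x + y) = cis x * cis y.
Proof. by rewrite /cis cosD sinD; simpc; rewrite [X in _ +i* X]addrC. Qed.

Lemma cisX x m : cis x ^+ m = cis (m%:R * x).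
Proof.
elim: m => [|m IH]; first by rewrite mul0r /cis cos0 sin0.
by rewrite exprS IH -cisD -natr1 mulrDl mul1r addrC.
Qed.

Lemma conj_cis x : ((cis x)^* = cis (- x))%R.
Proof. by rewrite /cis cosN sinN. Qed.

Lemma cis0 : cis 0 = 1.
Proof. by rewrite /cis cos0 sin0. Qed.

Lemma cisMconj x : (cis x)^* * cis x = 1.
Proof. by rewrite conj_cis -cisD addNr cis0. Qed.

Lemma cis_freqX n k : (0 < n)%N -> cis (freq n k) ^+ n = 1.
Proof. by move=> n0; rewrite cisX /cis cos_freqn// sin_freqn. Qed.

(** The discrete Fourier matrix, left unnormalized: it is unitary up to the factor [n] in its Gram
    matrix. *)
Definition fourier n : 'M[R[i]]_n := \matrix_(l < n, k < n) cis (freq n k) ^+ l.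

Lemma sum_expr_eq0 (z : R[i]) n : z ^+ n = 1 -> z != 1 -> \sum_(l < n) z ^+ l = 0.
Proof.
move=> zn z1; have := subrX1 z n; rewrite zn subrr => /esym/eqP.
by rewrite mulf_eq0 subr_eq0 (negbTE z1) => /eqP.
Qed.

Lemma cis_freq_neq n (j k : 'I_n) : j != k -> (cis (freq n j))^* * cis (freq n k) != 1.
Proof.
move=> jk; rewrite conj_cis -cisD; apply/eqP => -[+ _].
have n0 : 0 < n%:R :> R by rewrite ltr0n (leq_ltn_trans _ (ltn_ord j)).
have pi0 := @pi_gt0 R.
have H (a b : 'I_n) : (a < b)%N -> cos (freq n b - freq n a) < 1 :> R.
  move=> ab; rewrite /freq -mulrBr -mulrBl -natrB 1?ltnW//; apply: cos_lt1.
  have r0 : 0 < (b - a)%:R / n%:R :> R by rewrite divr_gt0// ltr0n subn_gt0.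
  have r1 : (b - a)%:R / n%:R < 1 :> R.
    by rewrite ltr_pdivrMr// mul1r ltr_nat (leq_ltn_trans (leq_subr _ _)).
  by rewrite mulr2n; nra.
have [kj|jk'] := ltnP k j.
  by rewrite -cosN opprD opprK addrC => /eqP; rewrite lt_eqF// addrC H.
rewrite addrC => /eqP; rewrite lt_eqF// H//.
by rewrite ltn_neqAle jk jk'.
Qed.

Lemma fourier_unitary n : (0 < n)%N ->
  (fourier n)^t* *m fourier n = (n%:R)%:M.
Proof.
move=> n0; apply/matrixP => j k; rewrite !mxE.
transitivity (\sum_(l < n) ((cis (freq n j))^* * cis (freq n k)) ^+ l).
  by apply: eq_bigr => l _; rewrite !mxE rmorphXn/= exprMn.
have [<-|jk] := eqVneq j k.
  under eq_bigr do rewrite cisMconj expr1n.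
  by rewrite sumr_const card_ord.
rewrite mulr0n; apply: sum_expr_eq0 (cis_freq_neq jk).
by rewrite exprMn -rmorphXn/= !cis_freqX// rmorph1 mulr1.
Qed.

Definition circ_eigenvalue n c (k : nat) : R[i] :=
  \sum_(l < n) (c l)%:C * cis (freq n k) ^+ l.

Lemma circ_fourier n c : (0 < n)%N ->
  circ n (fun l => (c l)%:C) *m fourier n =
  fourier n *m diag_mx (\row_k circ_eigenvalue n c k).
Proof.
case: n => // n _; apply/matrixP => j k; rewrite mul_mx_diag !mxE /circ_eigenvalue.
(* Addition of ordinals is cyclic, so this rotates the row [j] back to the first row. The
   wrap-around disappears because [cis (freq n k)] is an [n]-th root of unity. *)
rewrite mulr_sumr [LHS](reindex_inj (addrI j)); apply: eq_bigr => /= l _.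
rewrite !mxE mulrCA -exprD; congr ((c _)%:C * _).
  rewrite modnDml -addnA [(j + _)%N]addnC -addnA subnK 1?ltnW// addnC.
  by rewrite modnDl modn_small.
rewrite [in RHS](divn_eq (j + l) n.+1) exprD mulnC exprM cis_freqX// expr1n mul1r.
by [].
Qed.

(** Taking adjoints in [circ_fourier] shows that the same Fourier matrix diagonalizes the adjoint of
    [A], with conjugate eigenvalues. The eigenvalues of the product are therefore squared moduli. *)
Lemma gram_fourier n c : (0 < n)%N -> let A := circ n (fun l => (c l)%:C) in
  A^t* *m A *m fourier n =
  fourier n *m diag_mx (\row_k (`|circ_eigenvalue n c k| ^+ 2)).
Proof.
move=> n0 A; set F := fourier n; set L : 'rV[R[i]]_n := \row_k circ_eigenvalue n c k.
have AF : A *m F = F *m diag_mx L by exact: circ_fourier.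
have FF : F^t* *m F = (n%:R)%:M by exact: fourier_unitary.
have nn : (n%:R : R[i]) != 0 by rewrite pnatr_eq0 -lt0n.
have FFi : F *m F^t* = (n%:R)%:M.
  have /mulmx1C : (n%:R^-1 *: F^t*) *m F = 1%:M.
    by rewrite -scalemxAl FF scale_scalar_mx mulVf.
  rewrite -scalemxAr => /(congr1 (fun M => n%:R *: M)).
  by rewrite scalerA mulfV// scale1r scale_scalar_mx mulr1.
have FA : F^t* *m A^t* = (diag_mx L)^t* *m F^t*.
  by rewrite -!map_mxM -!trmx_mul AF.
have FAF : F^t* *m A^t* *m F = n%:R *: (diag_mx L)^t*.
  by rewrite FA -mulmxA FF mul_mx_scalar.
have AtF : A^t* *m F = F *m (diag_mx L)^t*.
  apply: (scalerI nn); rewrite -mul_scalar_mx -FFi -mulmxA [_ *m (_ *m F)]mulmxA FAF.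
  by rewrite scalemxAr.
rewrite -mulmxA AF mulmxA AtF -mulmxA; congr (F *m _).
apply/matrixP => i j; rewrite mul_mx_diag !mxE.
case: (eqVneq i j) => [->|_]; last by rewrite !mulr0n rmorph0 mul0r.
by rewrite !mulr1n normCK mulrC.
Qed.

Lemma eigenvalue_gram_circ n c a : (0 < n)%N -> let A := circ n (fun l => (c l)%:C) in
  eigenvalue (A^t* *m A) a <-> exists k : 'I_n, a = `|circ_eigenvalue n c k| ^+ 2.
Proof.
move=> n0 A; have GF := gram_fourier c n0; set F := fourier n in GF.
set D := diag_mx _ in GF.
have nn : (n%:R : R[i]) != 0 by rewrite pnatr_eq0 -lt0n.
have [_ Fu] : n%:R^-1 *: F^t* \in unitmx /\ F \in unitmx.
  by apply: mulmx1_unit; rewrite -scalemxAl fourier_unitary// scale_scalar_mx mulVf.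
split.
  move=> /eigenvalueP[v vG v0]; set u := v *m F.
  have : u *m D = a *: u by rewrite -mulmxA -GF !mulmxA -[v *m _ *m _]mulmxA vG scalemxAl.
  have u0 : u != 0.
    apply: contraNneq v0 => u0.
    by rewrite -(mulmxK Fu v) -/u u0 mul0mx.
  clearbody u; have [k uk] : exists k, u 0 k != 0.
    by case/rV0Pn: u0 => k uk; exists k.
  move/matrixP => /(_ 0 k); rewrite mul_mx_diag !mxE mulrC => /(mulIf uk) E.
  by exists k.
(* Eigenvectors are row vectors here: the witness is the [k]-th row of the inverse Fourier
   matrix. *)
move=> [k ->]; apply/eigenvalueP; exists (delta_mx 0 k *m invmx F).
  have GD : A^t* *m A = F *m D *m invmx F by rewrite -GF mulmxK.
  rewrite GD !mulmxA mulmxKV// scalemxAl; congr (_ *m _).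
  apply/matrixP => i j; rewrite mul_mx_diag !mxE.
  case: (eqVneq j k) => [->|_]; last by rewrite andbF mul0r mulr0.
  by rewrite mulrC.
apply/eqP => /(congr1 (mulmx^~ F)); rewrite mulmxKV// mul0mx.
by move/matrixP => /(_ 0 k)/eqP; rewrite !mxE !eqxx oner_eq0.
Qed.

Definition dft_re n c (k : nat) : R := \sum_(l < n) c l * cos (l%:R * freq n k).
Definition dft_im n c (k : nat) : R := \sum_(l < n) c l * sin (l%:R * freq n k).

Lemma circ_eigenvalueE n c k :
  circ_eigenvalue n c k = dft_re n c k +i* dft_im n c k.
Proof.
rewrite /circ_eigenvalue /dft_re /dft_im.
elim/big_rec3: _ => // l x y _ _ ->; rewrite cisX /cis; simpc.
by [].
Qed.

Lemma singular_value_circ n c s : (0 < n)%N ->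
  singular_value (circ n (fun l => (c l)%:C)) s <->
  0 <= s /\ exists k : 'I_n, s ^+ 2 = dft_re n c k ^+ 2 + dft_im n c k ^+ 2.
Proof.
move=> n0; rewrite /singular_value; split=> -[s0 H]; split=> //.
  have [k] := (eigenvalue_gram_circ c _ n0).1 H; rewrite -add_Re2_Im2 => /complexI ->.
  by exists k; rewrite circ_eigenvalueE.
have [k E] := H; apply: (eigenvalue_gram_circ c _ n0).2; exists k.
by rewrite -add_Re2_Im2 circ_eigenvalueE/= E.
Qed.

Lemma smallest_singular_value_circ_le n c (e : R) : (0 < n)%N -> 0 <= e ->
  smallest_singular_value (circ n (fun l => (c l)%:C)) <= e <->
  exists k : 'I_n, dft_re n c k ^+ 2 + dft_im n c k ^+ 2 <= e ^+ 2.
Proof.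
move=> n0 e0; rewrite /smallest_singular_value.
set S := [set s | _]; set N := fun k : 'I_n => dft_re n c k ^+ 2 + dft_im n c k ^+ 2.
have N0 k : 0 <= N k by rewrite addr_ge0// sqr_ge0.
have SN k : S (Num.sqrt (N k)).
  by apply/(singular_value_circ c _ n0); split; rewrite ?sqrtr_ge0//; exists k; rewrite sqr_sqrtr.
have lS : has_lbound S by exists 0 => s [].
split=> [infe|[k Nk]]; last first.
  apply: le_trans (ge_inf lS (SN k)) _.
  by rewrite -(ger0_norm e0) -sqrtr_sqr ler_sqrt// sqr_ge0.
pose k0 : 'I_n := Ordinal n0.
(* The infimum runs over finitely many moduli, so a least one attains it and the non-strict bound
   passes to that [k]. *)
have [k _ Hk] : exists2 k : 'I_n, true & forall l, N k <= N l.
  by case: (@arg_minP _ _ _ k0 xpredT N) => // k _ Hk; exists k => // l; exact: Hk.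
exists k; rewrite -/(N k) -(sqr_sqrtr (N0 k)) ler_sqr ?nnegrE ?sqrtr_ge0//.
apply: le_trans infe; apply: lb_le_inf; first by exists (Num.sqrt (N k)).
move=> s /(singular_value_circ c _ n0)[s0 [l E]].
by rewrite -(ger0_norm s0) -sqrtr_sqr ler_sqrt ?sqr_ge0// E Hk.
Qed.

End circulant_singular_values.
(** * Independence and characteristic functions *)

Section independence.
Context {R : realType} {d : measure_display} {T : measurableType d}
  (P : probability T R).
Import HBNNSimple.

Section ge0_integral_factor.
Local Open Scope ereal_scope.
Context (G : T -> R) (X : T -> R).
Hypotheses (mG : measurable_fun setT G) (G0 : forall x, (0 <= G x)%R)
  (Gfin : \int[P]_x (G x)%:E \is a fin_num) (mX : measurable_fun setT X)
  (XG : forall B, measurable B ->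
     \int[P]_x ((\1_B (X x))%:E * (G x)%:E) = P (X @^-1` B) * \int[P]_x (G x)%:E).

(** Independence of [X] and the weight [G] enters only through the indicator case [XG]; linearity
    over the finitely many values of [h] extends it to simple functions. *)
Lemma ge0_integral_factor_nnsfun (h : {nnsfun R >-> R}) :
  \int[P]_x ((h (X x))%:E * (G x)%:E) = (\int[P]_x (h (X x))%:E) * \int[P]_x (G x)%:E.
Proof.
have mpre r : measurable (X @^-1` (h @^-1` [set r])).
  by rewrite -[X in measurable X]setTI; exact: mX.
have mind r : measurable_fun setT (fun x => (\1_(h @^-1` [set r]) (X x) : R)).
  by apply: measurableT_comp => //; exact: measurable_indic.
transitivity (\sum_(r \in range h)
    \int[P]_x (r%:E * ((\1_(h @^-1` [set r]) (X x))%:E * (G x)%:E))).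
  rewrite -ge0_integral_fsum//; last 2 first.
  - move=> r; apply: emeasurable_funM => //; apply: emeasurable_funM => //.
    exact/measurable_EFinP.
    exact/measurable_EFinP.
  - move=> r x _; rewrite muleA; apply: mule_ge0 => //.
      by rewrite -EFinM; exact: nnfun_muleindic_ge0.
    by rewrite lee_fin.
  apply: eq_integral => x _; rewrite fimfunE -fsumEFin// ge0_mule_fsuml.
    by apply: eq_fsbigr => r _; rewrite EFinM muleA.
  by move=> r; exact: nnfun_muleindic_ge0.
have -> : \int[P]_x (h (X x))%:E =
    \sum_(r \in range h) \int[P]_x (r * \1_(h @^-1` [set r]) (X x))%:E.
  rewrite -ge0_integral_fsum//.
  - by apply: eq_integral => x _; rewrite fimfunE -fsumEFin.
  - move=> r; apply/measurable_EFinP; exact: measurable_funM.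
  - by move=> r x _; exact: nnfun_muleindic_ge0.
rewrite ge0_mule_fsuml; last first.
  by move=> r; apply: integral_ge0 => x _; exact: nnfun_muleindic_ge0.
apply: eq_fsbigr => r; rewrite inE => -[y _ hy].
have r0 : (0 <= r)%R by rewrite -hy.
rewrite ge0_integralZl//; last 2 first.
- by apply: emeasurable_funM; exact/measurable_EFinP.
- by move=> x _; rewrite mule_ge0// lee_fin.
under [X in _ = X * _]eq_integral do rewrite EFinM.
rewrite ge0_integralZl//; last exact/measurable_EFinP.
rewrite XG//; have -> : \int[P]_x (\1_(h @^-1` [set r]) (X x))%:E =
    P (X @^-1` (h @^-1` [set r])).
  by rewrite -[X in _ = P X]setIT -integral_indic.
by rewrite muleA.
Qed.

(** Monotone convergence along simple approximations of [f]. *)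
Lemma ge0_integral_factor (f : R -> \bar R) :
  measurable_fun setT f -> (forall y, 0 <= f y) ->
  \int[P]_x (f (X x) * (G x)%:E) = (\int[P]_x f (X x)) * \int[P]_x (G x)%:E.
Proof.
move=> mf f0; pose h := nnsfun_approx measurableT mf.
have hf y : (h n y)%:E @[n --> \oo] --> f y by exact: cvg_nnsfun_approx.
have mhX n : measurable_fun setT (fun x => (h n (X x))%:E).
  by apply/measurable_EFinP/measurableT_comp => //; exact/measurable_funP.
have ndh y m n : (m <= n)%N -> (h m y <= h n y)%R.
  by move=> mn; exact/lefP/nd_nnsfun_approx.
have limA : \int[P]_x ((h n (X x))%:E * (G x)%:E) @[n --> \oo] --> \int[P]_x (f (X x) * (G x)%:E).
  have -> : \int[P]_x (f (X x) * (G x)%:E) =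
      \int[P]_x limn (fun n => (h n (X x))%:E * (G x)%:E).
    apply: eq_integral => x _; apply/esym/cvg_lim => //.
    exact: cvgeZr.
  apply: cvg_monotone_convergence => //.
  - by move=> n; apply: emeasurable_funM => //; exact/measurable_EFinP.
  - by move=> n x _; rewrite mule_ge0// lee_fin.
  - by move=> x _ m n mn; rewrite lee_wpmul2r// lee_fin ?ndh//.
have limB : \int[P]_x (h n (X x))%:E @[n --> \oo] --> \int[P]_x f (X x).
  have -> : \int[P]_x f (X x) = \int[P]_x limn (fun n => (h n (X x))%:E).
    by apply: eq_integral => x _; exact/esym/cvg_lim.
  apply: cvg_monotone_convergence => //.
  - by move=> n x _; rewrite lee_fin.
  - by move=> x _ m n mn; rewrite lee_fin ndh.
have limC := cvgeZr Gfin limB.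
have E : (fun n => \int[P]_x ((h n (X x))%:E * (G x)%:E)) =
    (fun n => \int[P]_x (h n (X x))%:E * \int[P]_x (G x)%:E).
  by apply/funext => n; exact: ge0_integral_factor_nnsfun.
by rewrite E in limA; exact: (cvg_unique _ limA limC).
Qed.

End ge0_integral_factor.

(** On a probability space these functions are integrable and closed under the operations used
    below, which keeps the linearity of real integrals free of integrability side conditions. *)
Definition bounded_mfun (f : T -> R) :=
  measurable_fun setT f /\ exists M : R, forall x, `|f x| <= M.

Lemma bounded_mfun_integrable f : bounded_mfun f -> P.-integrable setT (EFin \o f).
Proof.
move=> [mf [M fM]]; apply: measurable_bounded_integrable => //.
  exact: le_lt_trans (probability_le1 P measurableT) (ltry 1).
exists M; split; first exact: num_real.
by move=> N MN x _ /=; rewrite (le_trans (fM x))// ltW.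
Qed.

Lemma bounded_mfunD f g : bounded_mfun f -> bounded_mfun g ->
  bounded_mfun (fun x => f x + g x).
Proof.
move=> [mf [M fM]] [mg [N gN]]; split; first exact: measurable_funD.
by exists (M + N) => x; rewrite (le_trans (ler_normD _ _))// lerD.
Qed.

Lemma bounded_mfunB f g : bounded_mfun f -> bounded_mfun g ->
  bounded_mfun (fun x => f x - g x).
Proof.
move=> [mf [M fM]] [mg [N gN]]; split; first exact: measurable_funB.
by exists (M + N) => x; rewrite (le_trans (ler_normB _ _))// lerD.
Qed.

Lemma bounded_mfunM f g : bounded_mfun f -> bounded_mfun g ->
  bounded_mfun (fun x => f x * g x).
Proof.
move=> [mf [M fM]] [mg [N gN]]; split; first exact: measurable_funM.
by exists (M * N) => x; rewrite normrM ler_pM.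
Qed.

Lemma bounded_mfun_cst c : bounded_mfun (fun=> c).
Proof. by split; [exact: measurable_cst|exists `|c|]. Qed.

Lemma bounded_mfun_sum (I : Type) (r : seq I) (f : I -> T -> R) :
  (forall i, bounded_mfun (f i)) -> bounded_mfun (fun x => \sum_(i <- r) f i x).
Proof.
move=> bf; elim: r => [|i r IH].
  by under eq_fun do rewrite big_nil; exact: bounded_mfun_cst.
by under eq_fun do rewrite big_cons; exact: bounded_mfunD.
Qed.

Lemma bounded_mfun_indic A : measurable A -> bounded_mfun (\1_A).
Proof.
move=> mA; split; first exact: measurable_indic.
by exists 1 => x; rewrite indicE ger0_norm// lern1 leq_b1.
Qed.

Lemma bounded_mfun_cos (f : T -> R) : measurable_fun setT f ->
  bounded_mfun (fun x => cos (f x)).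
Proof.
move=> mf; split; last by exists 1 => x; exact: cos_max.
by apply: measurableT_comp mf; apply: continuous_measurable_fun; exact: continuous_cos.
Qed.

Lemma bounded_mfun_sin (f : T -> R) : measurable_fun setT f ->
  bounded_mfun (fun x => sin (f x)).
Proof.
move=> mf; split; last by exists 1 => x; exact: sin_max.
by apply: measurableT_comp mf; apply: continuous_measurable_fun; exact: continuous_sin.
Qed.

Lemma bRintegralD f g : bounded_mfun f -> bounded_mfun g ->
  \int[P]_x (f x + g x) = \int[P]_x f x + \int[P]_x g x.
Proof. by move=> bf bg; rewrite RintegralD//; exact: bounded_mfun_integrable. Qed.

Lemma bRintegralB f g : bounded_mfun f -> bounded_mfun g ->
  \int[P]_x (f x - g x) = \int[P]_x f x - \int[P]_x g x.
Proof. by move=> bf bg; rewrite RintegralB//; exact: bounded_mfun_integrable. Qed.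

Lemma bRintegralZl f c : bounded_mfun f ->
  \int[P]_x (c * f x) = c * \int[P]_x f x.
Proof. by move=> bf; rewrite RintegralZl//; exact: bounded_mfun_integrable. Qed.

Lemma bRintegral_cst c : \int[P]_x c = c.
Proof.
transitivity (c * fine (P setT)); first exact: Rintegral_cst.
by rewrite probability_setT mulr1.
Qed.

Lemma bRintegral_sum (I : Type) (r : seq I) (f : I -> T -> R) :
  (forall i, bounded_mfun (f i)) ->
  \int[P]_x (\sum_(i <- r) f i x) = \sum_(i <- r) \int[P]_x f i x.
Proof.
move=> bf; elim: r => [|i r IH].
  by under eq_Rintegral do rewrite big_nil; rewrite big_nil bRintegral_cst.
under eq_Rintegral do rewrite big_cons.
by rewrite big_cons bRintegralD ?IH//; exact: bounded_mfun_sum.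
Qed.

Lemma bRintegral_le f g : bounded_mfun f -> bounded_mfun g ->
  (forall x, f x <= g x) -> \int[P]_x f x <= \int[P]_x g x.
Proof.
by move=> bf bg fg; apply: le_Rintegral => //; exact: bounded_mfun_integrable.
Qed.

Lemma bRintegral_indic A : measurable A -> \int[P]_x (\1_A x) = fine (P A).
Proof. by move=> mA; rewrite /Rintegral integral_indic// setIT. Qed.

Lemma EFin_Rintegral f : bounded_mfun f ->
  (\int[P]_x f x)%:E = (\int[P]_x (f x)%:E)%E.
Proof.
move=> bf; rewrite /Rintegral fineK//; apply: integrable_fin_num => //.
exact: bounded_mfun_integrable.
Qed.

Lemma ge0_bRintegral_factor (G : T -> R) (X : T -> R) (f : R -> R) :
  bounded_mfun G -> (forall x, 0 <= G x) -> measurable_fun setT X ->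
  measurable_fun setT f -> bounded_mfun (f \o X) -> (forall y, 0 <= f y) ->
  (forall B, measurable B ->
     \int[P]_x (\1_B (X x) * G x) = fine (P (X @^-1` B)) * \int[P]_x G x) ->
  \int[P]_x (f (X x) * G x) = (\int[P]_x f (X x)) * \int[P]_x G x.
Proof.
move=> bG G0 mX mf bfX f0 XG; have mG := bG.1.
have mpre B : measurable B -> measurable (X @^-1` B).
  by move=> mB; rewrite -[X in measurable X]setTI; exact: mX.
apply: EFin_inj; rewrite EFin_Rintegral; last exact: bounded_mfunM.
under eq_integral do rewrite EFinM.
rewrite (@ge0_integral_factor G X mG G0 _ mX _ (EFin \o f)).
- by rewrite EFinM !EFin_Rintegral.
- by rewrite -EFin_Rintegral.
- move=> B mB; transitivity ((\int[P]_x (\1_B (X x) * G x))%:E).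
    rewrite EFin_Rintegral; first by apply: eq_integral.
    by apply: bounded_mfunM => //; exact: (bounded_mfun_indic (mpre _ mB)).
  by rewrite XG// EFinM EFin_Rintegral// fineK// fin_num_measure//; exact: mpre.
- exact/measurable_EFinP.
- by move=> y; rewrite /= lee_fin.
Qed.

(** Adding the bounds [M] and [N] to [f] and [G] reduces to the nonnegative case. Expanding the
    product then cancels the terms containing [M] or [N]. *)
Lemma bRintegral_factor (G : T -> R) (X : T -> R) (f : R -> R) :
  bounded_mfun G -> measurable_fun setT X ->
  measurable_fun setT f -> (exists M, forall y, `|f y| <= M) ->
  (forall B, measurable B ->
     \int[P]_x (\1_B (X x) * G x) = fine (P (X @^-1` B)) * \int[P]_x G x) ->
  \int[P]_x (f (X x) * G x) = (\int[P]_x f (X x)) * \int[P]_x G x.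
Proof.
move=> bG mX mf [M fM] XG; have [mG [N GN]] := bG.
have bf : bounded_mfun (f \o X).
  by split; [exact: measurableT_comp|exists M => x; exact: fM].
have bc := bounded_mfun_cst.
have mpre B : measurable B -> measurable (X @^-1` B).
  by move=> mB; rewrite -[X in measurable X]setTI; exact: mX.
have := @ge0_bRintegral_factor (fun x => G x + N) X (fun y => f y + M).
have -> : \int[P]_x (G x + N) = \int[P]_x G x + N.
  by rewrite bRintegralD// bRintegral_cst.
have -> : \int[P]_x (f (X x) + M) = \int[P]_x f (X x) + M.
  by rewrite (bRintegralD bf)// bRintegral_cst.
have -> : \int[P]_x ((f (X x) + M) * (G x + N)) =
    \int[P]_x (f (X x) * G x) + N * \int[P]_x f (X x) + M * \int[P]_x G x + M * N.
  transitivity (\int[P]_x (f (X x) * G x + N * f (X x) + M * G x + M * N)).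
    by apply: eq_Rintegral => x _; ring.
  rewrite bRintegralD// ?bRintegral_cst; last first.
    apply: bounded_mfunD; last exact: bounded_mfunM.
    by apply: bounded_mfunD; exact: bounded_mfunM.
  congr (_ + _); rewrite bRintegralD// ?bRintegralZl//; last 2 first.
    by apply: bounded_mfunD; exact: bounded_mfunM.
    exact: bounded_mfunM.
  congr (_ + _); rewrite bRintegralD// ?(bRintegralZl _ bf)//; exact: bounded_mfunM.
move=> H; suff E : \int[P]_x (f (X x) * G x) + N * \int[P]_x f (X x) +
    M * \int[P]_x G x + M * N = (\int[P]_x f (X x) + M) * (\int[P]_x G x + N).
  by move: E; lra.
apply: H.
- exact: bounded_mfunD.
- by move=> x; have := GN x; rewrite ler_norml => /andP[]; lra.
- by [].
- exact: measurable_funD.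
- exact: (bounded_mfunD bf (bc M)).
- by move=> y; have := fM y; rewrite ler_norml => /andP[]; lra.
move=> B mB; have bB := bounded_mfun_indic (mpre _ mB).
transitivity (\int[P]_x (\1_B (X x) * G x + N * \1_(X @^-1` B) x)).
  by apply: eq_Rintegral => x _; rewrite mulrDr [N * _]mulrC.
rewrite bRintegralD ?XG// ?bRintegralZl// ?bRintegral_indic//; last 3 first.
- exact: mpre.
- exact: bounded_mfunM.
- exact: bounded_mfunM.
ring.
Qed.

End independence.

(** * Characteristic functions of linear combinations of independent variables *)

Section characteristic_function.
Context {R : realType} {d : measure_display} {T : measurableType d}
  (P : probability T R) (X : nat -> {RV P >-> R}).
Hypothesis indepX : mutually_independent X.
Implicit Types (y : nat -> R) (J : {fset nat}) (B : nat -> set R) (js : seq nat).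

Definition cylinder J B := \bigcap_(k in [set` J]) (X k @^-1` B k).

Lemma measurable_preimage_RV k (A : set R) : measurable A -> measurable (X k @^-1` A).
Proof. by move=> mA; rewrite -[X in measurable X]setTI; exact: measurable_funP. Qed.

Lemma measurable_cylinder J B : (forall k, k \in J -> measurable (B k)) ->
  measurable (cylinder J B).
Proof.
move=> mB; apply: fin_bigcap_measurable; first exact: finite_fset.
by move=> k kJ; apply: measurable_preimage_RV; exact: mB.
Qed.

Lemma cylinderU1 j J B (A : set R) : j \notin J ->
  X j @^-1` A `&` cylinder J B =
  cylinder (j |` J)%fset (fun k => if k == j then A else B k).
Proof.
move=> jJ; apply/seteqP; split=> [w [Aw BJ] k|w BJ]; rewrite /= ?inE.
- move=> /orP[/eqP->|kJ]; first by rewrite /= eqxx.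
  have -> : (k == j) = false by apply: contraNF jJ => /eqP <-.
  exact: BJ.
- split; first by have := BJ j; rewrite /= eqxx; apply; exact: fset1U1.
  move=> k /= kJ; have := BJ k; rewrite /=.
  have -> : (k == j) = false by apply: contraNF jJ => /eqP <-.
  by apply; rewrite inE kJ orbT.
Qed.

Lemma probability_cylinderU1 j J B (A : set R) : j \notin J -> measurable A ->
  (forall k, k \in J -> measurable (B k)) ->
  fine (P (X j @^-1` A `&` cylinder J B)) =
  fine (P (X j @^-1` A)) * fine (P (cylinder J B)).
Proof.
move=> jJ mA mB; rewrite cylinderU1// -fineM; last 2 first.
- by apply: fin_num_measure; exact: measurable_preimage_RV.
- by apply: fin_num_measure; exact: measurable_cylinder.
congr fine; rewrite /cylinder indepX; last first.
  by move=> k; rewrite !inE; case: eqP => //= _ kJ; exact: mB.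
rewrite big_fsetU1//= eqxx indepX//; congr (_ * _)%E.
rewrite big_seq [RHS]big_seq; apply: eq_bigr => k kJ.
by have -> : (k == j) = false by apply: contraNF jJ => /eqP <-.
Qed.

(* Real and imaginary parts of the product of the characteristic functions of
   the [X j], [j] in [js], at [y j]. *)
Fixpoint char_prod y js : R * R :=
  if js is j :: js' then
    let c := \int[P]_w cos (y j * X j w) in
    let s := \int[P]_w sin (y j * X j w) in
    let: (u, v) := char_prod y js' in (c * u - s * v, s * u + c * v)
  else (1, 0).

Lemma char_prod_sqr y js :
  (char_prod y js).1 ^+ 2 + (char_prod y js).2 ^+ 2 =
  \prod_(j <- js) ((\int[P]_w cos (y j * X j w)) ^+ 2 +
                   (\int[P]_w sin (y j * X j w)) ^+ 2).
Proof.
elim: js => [|j js IH]; first by rewrite big_nil /= expr1n expr0n addr0.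
rewrite big_cons -IH /=; case: (char_prod y js) => u v /=.
ring.
Qed.

Let lin y js w := \sum_(j <- js) y j * X j w.

Lemma measurable_lin y js : measurable_fun setT (lin y js).
Proof. by apply: measurable_sum => j; apply: measurable_funM => //; exact: measurable_cst. Qed.

(** Independence is given for events only. Carrying the indicator of a cylinder over the indices
    outside [js] makes the claim inductive: variables are split off one at a time by
    [bRintegral_factor]. *)
Lemma Rintegral_char_cylinder y js J B : uniq js -> (forall j, j \in js -> j \notin J) ->
  (forall k, k \in J -> measurable (B k)) ->
  \int[P]_w (cos (lin y js w) * \1_(cylinder J B) w) =
    (char_prod y js).1 * fine (P (cylinder J B)) /\
  \int[P]_w (sin (lin y js w) * \1_(cylinder J B) w) =
    (char_prod y js).2 * fine (P (cylinder J B)).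
Proof.
elim: js J B => [|j js IH] J B.
  move=> _ _ mB; have mJ := measurable_cylinder mB.
  split.
    under eq_Rintegral do rewrite /lin big_nil cos0 mul1r.
    by rewrite bRintegral_indic// mul1r.
  under eq_Rintegral do rewrite /lin big_nil sin0 mul0r.
  by rewrite bRintegral_cst mul0r.
move=> /andP[jjs ujs] dJ mB; have mJ := measurable_cylinder mB.
have jJ : j \notin J by apply: dJ; rewrite mem_head.
have djsJ k : k \in js -> k \notin J by move=> kjs; apply: dJ; rewrite inE kjs orbT.
have [IHc IHs] := IH J B ujs djsJ mB.
have bcyl : bounded_mfun (\1_(cylinder J B) : T -> R) by exact: bounded_mfun_indic.
have bc : bounded_mfun (fun w => cos (lin y js w) * \1_(cylinder J B) w).
  by apply: bounded_mfunM bcyl; apply: bounded_mfun_cos; exact: measurable_lin.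
have bs : bounded_mfun (fun w => sin (lin y js w) * \1_(cylinder J B) w).
  by apply: bounded_mfunM bcyl; apply: bounded_mfun_sin; exact: measurable_lin.
have mX : measurable_fun setT (X j) by [].
(* The event on [X j] is absorbed into the cylinder, to which the induction hypothesis applies; this
   is the indicator case that the factorization needs. *)
have IHA (A : set R) : measurable A ->
    \int[P]_w (\1_A (X j w) * (cos (lin y js w) * \1_(cylinder J B) w)) =
      fine (P (X j @^-1` A)) * \int[P]_w (cos (lin y js w) * \1_(cylinder J B) w) /\
    \int[P]_w (\1_A (X j w) * (sin (lin y js w) * \1_(cylinder J B) w)) =
      fine (P (X j @^-1` A)) * \int[P]_w (sin (lin y js w) * \1_(cylinder J B) w).
  move=> mA; pose B' := fun k => if k == j then A else B k.
  have [||Hc Hs] := IH (j |` J)%fset B' ujs.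
  - move=> k kjs; rewrite !inE negb_or djsJ// andbT.
    by apply: contraNneq jjs => <-.
  - by move=> k; rewrite !inE /B'; case: eqP => //= _ kJ; exact: mB.
  move: Hc Hs; rewrite -cylinderU1// probability_cylinderU1// => Hc Hs.
  have E w : \1_(X j @^-1` A `&` cylinder J B) w =
      \1_A (X j w) * \1_(cylinder J B) w :> R by rewrite indicI.
  split.
    rewrite IHc mulrCA -Hc; apply: eq_Rintegral => w _.
    by rewrite E mulrCA.
  rewrite IHs mulrCA -Hs; apply: eq_Rintegral => w _.
  by rewrite E mulrCA.
have mcos : measurable_fun setT (fun x : R => cos (y j * x)).
  by apply: continuous_measurable_fun => x; apply: continuous_comp;
    [exact: mulrl_continuous|exact: continuous_cos].
have msin : measurable_fun setT (fun x : R => sin (y j * x)).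
  by apply: continuous_measurable_fun => x; apply: continuous_comp;
    [exact: mulrl_continuous|exact: continuous_sin].
have Mcos : exists M : R, forall x, `|cos (y j * x)| <= M by exists 1 => x; exact: cos_max.
have Msin : exists M : R, forall x, `|sin (y j * x)| <= M by exists 1 => x; exact: sin_max.
have FC f (mf : measurable_fun setT f) Mf :=
  @bRintegral_factor _ _ _ P _ (X j) f bc mX mf Mf (fun A mA => (IHA A mA).1).
have FS f (mf : measurable_fun setT f) Mf :=
  @bRintegral_factor _ _ _ P _ (X j) f bs mX mf Mf (fun A mA => (IHA A mA).2).
have mlin : measurable_fun setT (fun w => y j * X j w).
  by apply: measurable_funM => //; exact: measurable_cst.
have bcj := bounded_mfun_cos mlin; have bsj := bounded_mfun_sin mlin.
rewrite /=; case E : (char_prod y js) => [u v] /=; rewrite E/= in IHc IHs.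
split.
  transitivity (\int[P]_w (cos (y j * X j w) * (cos (lin y js w) * \1_(cylinder J B) w)
     - sin (y j * X j w) * (sin (lin y js w) * \1_(cylinder J B) w))).
    by apply: eq_Rintegral => w _; rewrite /lin big_cons cosD; ring.
  rewrite bRintegralB; [|exact: bounded_mfunM..].
  by rewrite (FC _ mcos)// (FS _ msin)// IHc IHs; ring.
transitivity (\int[P]_w (sin (y j * X j w) * (cos (lin y js w) * \1_(cylinder J B) w)
     + cos (y j * X j w) * (sin (lin y js w) * \1_(cylinder J B) w))).
  by apply: eq_Rintegral => w _; rewrite /lin big_cons sinD; ring.
rewrite bRintegralD; [|exact: bounded_mfunM..].
by rewrite (FC _ msin)// (FS _ mcos)// IHc IHs; ring.
Qed.

Lemma Rintegral_cos_sum y js : uniq js ->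
  \int[P]_w cos (\sum_(j <- js) y j * X j w) = (char_prod y js).1.
Proof.
move=> ujs; have [] := @Rintegral_char_cylinder y js fset0 (fun=> set0) ujs.
- by move=> j _; rewrite inE.
- by move=> k; rewrite inE.
have -> : cylinder fset0 (fun=> set0) = setT.
  by apply/seteqP; split=> // w _ k; rewrite /= inE.
rewrite probability_setT mulr1 => <- _.
by apply: eq_Rintegral => w _; rewrite indicT mulr1.
Qed.

Hypothesis distrX : forall k, equal_in_distribution (X k) (X 0%N).

Lemma Rintegral_comp_distr (f : R -> R) k : measurable_fun setT f ->
  bounded_mfun (f \o X 0%N) -> bounded_mfun (f \o X k) ->
  \int[P]_w f (X k w) = \int[P]_w f (X 0%N w).
Proof.
move=> mf b0 bk; rewrite /Rintegral; congr fine.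
have mfE : measurable_fun setT (EFin \o f) by exact/measurable_EFinP.
have int j : bounded_mfun (f \o X j) -> P.-integrable setT ((EFin \o f) \o X j).
  by move=> bj; exact: (bounded_mfun_integrable P bj).
rewrite -(integral_distribution mfE (int k bk)) -(integral_distribution mfE (int 0%N b0)).
by apply: eq_measure_integral => A mA _; exact: distrX.
Qed.

Let cos_distr (s : R) k :
  \int[P]_w cos (s * X k w) = \int[P]_w cos (s * X 0%N w).
Proof.
apply: (@Rintegral_comp_distr (fun x => cos (s * x))).
- by apply: continuous_measurable_fun => x; apply: continuous_comp;
    [exact: mulrl_continuous|exact: continuous_cos].
- by apply: bounded_mfun_cos; apply: measurable_funM => //; exact: measurable_cst.
- by apply: bounded_mfun_cos; apply: measurable_funM => //; exact: measurable_cst.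
Qed.

Let sin_distr (s : R) k :
  \int[P]_w sin (s * X k w) = \int[P]_w sin (s * X 0%N w).
Proof.
apply: (@Rintegral_comp_distr (fun x => sin (s * x))).
- by apply: continuous_measurable_fun => x; apply: continuous_comp;
    [exact: mulrl_continuous|exact: continuous_sin].
- by apply: bounded_mfun_sin; apply: measurable_funM => //; exact: measurable_cst.
- by apply: bounded_mfun_sin; apply: measurable_funM => //; exact: measurable_cst.
Qed.

(* The characteristic function of the symmetrization [X 0 - X 1] is the squared
   modulus of that of [X 0]. *)
Lemma Rintegral_cos_symmetrized (s : R) :
  \int[P]_w cos (s * (X 0%N w - X 1%N w)) =
  (\int[P]_w cos (s * X 0%N w)) ^+ 2 + (\int[P]_w sin (s * X 0%N w)) ^+ 2.
Proof.
have := @Rintegral_cos_sum (fun k => if k == 0%N then s else - s) [:: 0%N; 1%N] isT.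
under eq_Rintegral do rewrite !big_cons big_nil /= addr0 mulNr -mulrBr.
move=> ->; rewrite /= !mulr1 !mulr0 subr0 addr0.
have -> : \int[P]_w cos (- s * X 1%N w) = \int[P]_w cos (s * X 0%N w).
  rewrite -(cos_distr s 1%N); apply: eq_Rintegral => w _; by rewrite mulNr cosN.
have -> : \int[P]_w sin (- s * X 1%N w) = - \int[P]_w sin (s * X 0%N w).
  rewrite -(sin_distr s 1%N) -[RHS]mulN1r -bRintegralZl.
    by apply: eq_Rintegral => w _; rewrite mulNr sinN mulN1r.
  by apply: bounded_mfun_sin; apply: measurable_funM => //; exact: measurable_cst.
ring.
Qed.

(** The squared real part is at most the squared modulus, a product of characteristic functions of
    the symmetrization. Each factor [z] is at most [exp (- (1 - z))]. *)
Lemma sqr_Rintegral_cos_sum_le y n :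
  (\int[P]_w cos (\sum_(j < n) y j * X j w)) ^+ 2 <=
  expR (- \int[P]_w \sum_(j < n) (1 - cos (y j * (X 0%N w - X 1%N w)))).
Proof.
have -> : \int[P]_w cos (\sum_(j < n) y j * X j w) = (char_prod y (iota 0 n)).1.
  rewrite -Rintegral_cos_sum ?iota_uniq//; apply: eq_Rintegral => w _.
  by rewrite -(big_mkord xpredT (fun j => y j * X j w)) /index_iota subn0.
apply: (@le_trans _ _ (\prod_(j <- iota 0 n) ((\int[P]_w cos (y j * X j w)) ^+ 2 +
                   (\int[P]_w sin (y j * X j w)) ^+ 2))).
  by rewrite -char_prod_sqr lerDl sqr_ge0.
have msym s : measurable_fun setT (fun w => s * (X 0%N w - X 1%N w)).
  by apply: measurable_funM; [exact: measurable_cst|exact: measurable_funB].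
have bsym s : bounded_mfun (fun w => 1 - cos (s * (X 0%N w - X 1%N w))).
  by apply: bounded_mfunB; [exact: bounded_mfun_cst|exact: bounded_mfun_cos].
rewrite bRintegral_sum// -sumrN expR_sum.
rewrite -(big_mkord xpredT (fun j => expR (- \int[P]_w (1 - cos (y j * (X 0%N w - X 1%N w)))))).
rewrite /index_iota subn0; apply: ler_prod => j _.
rewrite addr_ge0 ?sqr_ge0//= cos_distr sin_distr -Rintegral_cos_symmetrized.
rewrite bRintegralB ?bRintegral_cst//; last 2 first.
- exact: bounded_mfun_cst.
- exact: bounded_mfun_cos.
rewrite opprB; apply: le_trans (expR_ge1Dx _); lra.
Qed.

End characteristic_function.
(** * Small ball probabilities *)

Section small_ball.
Context {R : realType} {d : measure_display} {T : measurableType d}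
  (P : probability T R).

(* A discrete Esseen inequality: on [S] all the angles are small, so the sum of
   [exp (i theta)] has modulus at least half the number of terms. *)
Lemma esseen (I : finType) (theta : I -> T -> R) (S : set T) (delta : R) :
  (0 < #|I|)%N -> 0 <= delta -> measurable S ->
  (forall p, measurable_fun setT (theta p)) ->
  (forall w p, S w -> `|theta p w| <= 1) ->
  (forall p q, p != q -> \int[P]_w cos (theta p w - theta q w) <= delta) ->
  fine (P S) <= 4 * (#|I|%:R^-1 + delta).
Proof.
move=> I0 d0 mS mth Sth Hd; set N : R := #|I|%:R.
have N0 : 0 < N by rewrite ltr0n.
have bcos p q : bounded_mfun (fun w => cos (theta p w - theta q w)).
  by apply: bounded_mfun_cos; exact: measurable_funB.
have bq p : bounded_mfun (fun w => \sum_q cos (theta p w - theta q w)).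
  exact: bounded_mfun_sum.
have bpq : bounded_mfun (fun w => \sum_p \sum_q cos (theta p w - theta q w)).
  exact: bounded_mfun_sum.
(* The double sum is the squared modulus of the sum of [exp (i theta)]. On [S] each cosine is at
   least 1/2, whence [N^2 / 4]; in the mean the diagonal contributes [N] and the other terms at most
   [N^2 delta]. *)
have H1 : \int[P]_w (N ^+ 2 / 4 * \1_S w) <=
    \int[P]_w \sum_p \sum_q cos (theta p w - theta q w).
  apply: bRintegral_le => //.
    by apply: bounded_mfunM; [exact: bounded_mfun_cst|exact: bounded_mfun_indic].
  move=> w; have -> : \sum_p \sum_q cos (theta p w - theta q w) =
      (\sum_p cos (theta p w)) ^+ 2 + (\sum_p sin (theta p w)) ^+ 2.
    rewrite !expr2 !mulr_suml -big_split; apply: eq_bigr => p _.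
    rewrite !mulr_sumr -big_split; apply: eq_bigr => q _.
    by rewrite cosB.
  have [Sw|Sw] := pselect (S w); last first.
    by rewrite indicE memNset// mulr0 addr_ge0// sqr_ge0.
  rewrite indicE mem_set// mulr1.
  have : N / 2 <= \sum_p cos (theta p w).
    rewrite /N -sum1_card natr_sum mulr_suml; apply: ler_sum => p _.
    have := oneBcos_le (theta p w); have := Sth w p Sw.
    by rewrite ler_norml => /andP[]; nra.
  have := sqr_ge0 (\sum_p sin (theta p w)); nra.
have H2 : \int[P]_w \sum_p \sum_q cos (theta p w - theta q w) <= N + N ^+ 2 * delta.
  rewrite bRintegral_sum//.
  have -> : N + N ^+ 2 * delta = \sum_(p : I) (1 + N * delta).
    by rewrite sumr_const -/N -[RHS]mulr_natl -/N; ring.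
  apply: ler_sum => p _; rewrite bRintegral_sum// (bigD1 p)//= lerD//.
    under eq_Rintegral do rewrite subrr cos0.
    by rewrite bRintegral_cst.
  apply: (@le_trans _ _ (\sum_(q | q != p) delta)).
    by apply: ler_sum => q qp; apply: Hd; rewrite eq_sym.
  rewrite sumr_const -[leLHS]mulr_natl ler_wpM2r// ler_nat.
  exact: max_card.
have := le_trans H1 H2; rewrite bRintegralZl; last exact: bounded_mfun_indic.
rewrite bRintegral_indic// => H3.
rewrite -(ler_pM2l (_ : 0 < N ^+ 2 / 4)); last by rewrite divr_gt0// exprn_gt0.
apply: (le_trans H3); rewrite le_eqVlt; apply/orP; left; apply/eqP.
by field; rewrite gt_eqF.
Qed.

Lemma Rintegral_ge_indic (f : T -> R) (S : set T) (L : R) :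
  bounded_mfun f -> measurable S -> (forall w, 0 <= f w) ->
  (forall w, S w -> L <= f w) -> fine (P S) * L <= \int[P]_w f w.
Proof.
move=> bf mS f0 fL; rewrite mulrC -bRintegral_indic//.
have bS : bounded_mfun (\1_S : T -> R) by exact: bounded_mfun_indic.
rewrite -bRintegralZl//; apply: bRintegral_le => //.
  by apply: bounded_mfunM => //; exact: bounded_mfun_cst.
move=> w; have [Sw|Sw] := pselect (S w).
  by rewrite indicE mem_set// mulr1 fL.
by rewrite indicE memNset// mulr0.
Qed.

End small_ball.

(** * Non-degeneracy of the symmetrized variable *)

Section nondegeneracy.
Context {R : realType}.
Local Open Scope ereal_scope.

(** With mean zero, the positive and negative parts have equal integrals. If one part vanishes
    almost surely, so does the other, and [X] is almost surely 0. *)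
Lemma variance_eq0_of_sign {d : measure_display} {T : measurableType d}
  (P : probability T R) (X : {RV P >-> R}) : 'E_P[X] = 0 ->
  P (X @^-1` [set x | 0 < x]%R) = 0 \/ P (X @^-1` [set x | x <= 0]%R) = 0 ->
  'V_P[X] = 0.
Proof.
move=> X0 H; have mX : measurable_fun setT (EFin \o X) by exact/measurable_EFinP.
set f := EFin \o X in mX.
have mp : measurable_fun setT (f^\+) by exact: measurable_funepos.
have mn : measurable_fun setT (f^\-) by exact: measurable_funeneg.
have E0 : \int[P]_w f^\+ w - \int[P]_w f^\- w = 0.
  by rewrite -integralE -X0 unlock.
have mpre (A : set R) : measurable A -> measurable (X @^-1` A).
  by move=> mA; rewrite -[X in measurable X]setTI; exact: measurable_funP.
have [p0 n0] : \int[P]_w f^\+ w = 0 /\ \int[P]_w f^\- w = 0.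
  case: H => H0.
    have p0 : \int[P]_w f^\+ w = 0.
      rewrite -(integral0 P setT); apply: ge0_ae_eq_integral => //.
      exists (X @^-1` [set x | 0 < x]%R); split => //.
        by apply: mpre; rewrite -set_itvoy; exact: measurable_itv.
      move=> w /= Hw; rewrite ltNge; apply/negP => Xw; apply: Hw => _.
      by rewrite funeposE/= max_r// lee_fin.
    by split => //; move: E0; rewrite p0 sub0e => /eqP; rewrite oppe_eq0 => /eqP.
  have n0 : \int[P]_w f^\- w = 0.
    rewrite -(integral0 P setT); apply: ge0_ae_eq_integral => //.
    exists (X @^-1` [set x | x <= 0]%R); split => //.
      by apply: mpre; rewrite -set_itvNyc; exact: measurable_itv.
    move=> w /= Hw; rewrite leNgt; apply/negP => Xw; apply: Hw => _.
    by rewrite funenegE/= max_r// lee_fin oppr_le0 ltW.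
  by split => //; move: E0; rewrite n0 sube0.
have abs0 : \int[P]_w `|f w| = 0.
  rewrite -[X in \int[P]_w X w]/(abse \o f) fune_abse.
  by rewrite ge0_integralD// p0 n0 adde0.
have ae0 : ae_eq P setT f (cst 0) by apply/ae_eq_integral_abs.
rewrite /variance unlock X0/= unlock.
rewrite -(integral0 P setT); apply: ge0_ae_eq_integral => //.
- apply/measurable_EFinP; apply: measurable_funM; apply: measurable_funB => //;
    exact: measurable_cst.
- by move=> w _; rewrite lee_fin/= -expr2 sqr_ge0.
apply: filterS ae0 => w /= fw _; have [Xw] : (X w)%:E = 0%:E := fw I.
by rewrite -[LHS]/(((X w - 0) * (X w - 0))%:E)%R Xw subrr mulr0.
Qed.


Context {d : measure_display} {T : measurableType d}
  (P : probability T R) (X : nat -> {RV P >-> R}).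

Lemma probability_indep2 (A B : set R) : mutually_independent X ->
  measurable A -> measurable B ->
  P (X 0%N @^-1` A `&` X 1%N @^-1` B) = P (X 0%N @^-1` A) * P (X 1%N @^-1` B).
Proof.
move=> indepX mA mB.
have := indepX [fset 0%N; 1%N]%fset (fun k => if k == 0%N then A else B).
rewrite big_fsetU1 ?inE//= big_seq_fset1/= => <-; last by move=> k _; case: ifP.
congr (P _); apply/seteqP; split=> [w [Aw Bw] k|w H].
  by rewrite /= !inE => /orP[]/eqP->.
by split; [apply: (H 0%N)|apply: (H 1%N)]; rewrite /= !inE.
Qed.

Lemma measurable_symmetrized (A B : R) :
  measurable [set w | (A <= `|X 0%N w - X 1%N w| <= B)%R].
Proof.
have mD : measurable_fun setT (fun w => `|X 0%N w - X 1%N w|%R).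
  by apply: measurableT_comp => //; exact: measurable_funB.
have := mD measurableT `[A, B]%classic (measurable_itv _).
by rewrite setTI set_itvcc.
Qed.

(** Otherwise [X 0 = X 1] almost surely, so the event [X 0 > 0 >= X 1] is null. By independence [xi]
    is then almost surely positive or almost surely nonpositive, against its positive variance. *)
Lemma exists_symmetrized_bulk {d0 : measure_display} {T0 : measurableType d0}
    (P0 : probability T0 R) (xi : {RV P0 >-> R}) :
  mutually_independent X -> (forall k, equal_in_distribution (X k) xi) ->
  'E_P0[xi] = 0 -> 0 < 'V_P0[xi] ->
  exists A B : R, [/\ (0 < A)%R, (0 < B)%R &
    0 < P [set w | (A <= `|X 0%N w - X 1%N w| <= B)%R]].
Proof.
move=> indepX distrX xi0 Vxi; apply: contrapT => H.
(* These windows exhaust all nonzero values of the difference. *)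
pose F (n : nat) := [set w | (n.+1%:R^-1 <= `|X 0%N w - X 1%N w| <= n.+1%:R)%R].
have F0 n : P (F n) = 0.
  apply/eqP; rewrite eq_le measure_ge0 andbT leNgt; apply/negP => PF.
  apply: H; by exists n.+1%:R^-1%R, n.+1%:R; split.
have nF : P.-negligible (\bigcup_n F n).
  apply: negligible_bigcup => n; apply/negligibleP; last exact: F0.
  exact: measurable_symmetrized.
have XF w : X 0%N w <> X 1%N w -> (\bigcup_n F n) w.
  move=> X01; have D0 : (0 < `|X 0%N w - X 1%N w|)%R.
    by rewrite normr_gt0 subr_eq0; exact/eqP.
  have [n1 Hn1] : exists n, (`|X 0%N w - X 1%N w| <= n.+1%:R)%R.
    by have := archi_boundP (ltW D0); set N := Num.Def.archi_bound _ => h;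
      exists N; rewrite (le_trans (ltW h))// ler_nat.
  have [n2 Hn2] : exists n, (n.+1%:R^-1 <= `|X 0%N w - X 1%N w|)%R.
    have iD0 : (0 <= `|X 0%N w - X 1%N w|^-1)%R by rewrite invr_ge0.
    have := archi_boundP iD0; set N := Num.Def.archi_bound _ => h.
    exists N; rewrite -[leRHS]invrK lef_pV2 ?posrE ?invr_gt0//.
    by rewrite (le_trans (ltW h))// ler_nat.
  exists (maxn n1 n2) => //; rewrite /F/=; apply/andP; split.
    by rewrite (le_trans _ Hn2)// lef_pV2 ?posrE// ler_nat ltnS leq_maxr.
  by rewrite (le_trans Hn1)// ler_nat ltnS leq_maxl.
have mpos : measurable ([set x | 0 < x]%R : set R).
  by rewrite -set_itvoy; exact: measurable_itv.
have mneg : measurable ([set x | x <= 0]%R : set R).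
  by rewrite -set_itvNyc; exact: measurable_itv.
have := probability_indep2 indepX mpos mneg.
rewrite (_ : P (_ `&` _) = 0); last first.
  apply: measure_negligible; first by apply: measurableI; exact: measurable_preimage_RV.
  apply: negligibleS nF => w /= [X0 X1]; apply: XF => E.
  by move: X0; rewrite E ltNge X1.
have Ex k (A : set R) : measurable A -> P (X k @^-1` A) = P0 (xi @^-1` A).
  by move=> mA; exact: distrX.
rewrite !Ex// => /esym/eqP; rewrite mule_eq0 => PP.
have : 'V_P0[xi] = 0.
  by apply: variance_eq0_of_sign => //; case/orP: PP => /eqP ->; [left|right].
by move=> V0; rewrite V0 ltxx in Vxi.
Qed.

End nondegeneracy.

(** * Small ball probabilities of the Fourier sums and the union bound *)

Lemma sqr_ord_diff {R : realDomainType} M (i j : 'I_M) :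
  (i != j)%:R <= (i%:R - j%:R : R) ^+ 2 <= M%:R ^+ 2.
Proof.
wlog ij : i j / (j <= i)%N.
  move=> H; have [/H//|/ltnW ij] := leqP j i.
  by rewrite eq_sym -sqrrN opprB; exact: H.
rewrite -natrB//; apply/andP; split; last first.
  by rewrite ler_sqr ?nnegrE ?ler0n// ler_nat (leq_trans (leq_subr _ _))// ltnW.
have [->|ne] := eqVneq i j; first by rewrite sqr_ge0.
rewrite exprn_ege1// ler1n subn_gt0 ltn_neqAle ij andbT.
by rewrite eq_sym.
Qed.

Section dft_small_ball.
Context {R : realType} {d : measure_display} {T : measurableType d}
  (P : probability T R) (X : nat -> {RV P >-> R}).
Hypotheses (indepX : mutually_independent X)
  (distrX : forall k, equal_in_distribution (X k) (X 0%N)).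
Context (A B : R).
Hypotheses (A0 : 0 < A) (B0 : 0 < B).
Let p := fine (P [set w | A <= `|X 0%N w - X 1%N w| <= B]).

Lemma lin_dft n k (a b : R) (c : nat -> R) :
  a * dft_re n c k + b * dft_im n c k =
  \sum_(j < n) wave a b (freq n k) j * c j.
Proof.
rewrite /dft_re /dft_im !mulr_sumr -big_split; apply: eq_bigr => j _ /=.
by rewrite /wave; ring.
Qed.

(** The mean energy is at least [p L], by restriction to the event of probability [p] where the
    symmetrization lies in the window. The factor 1/2 comes from the square root of
    [sqr_Rintegral_cos_sum_le]. *)
Lemma Rintegral_cos_dft_le n k (a b L : R) :
  (forall x, A <= `|x| <= B -> L <= energy (x * a) (x * b) (freq n k) n) ->
  \int[P]_w cos (a * dft_re n (X^~ w) k + b * dft_im n (X^~ w) k) <=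
  expR (- (p * L / 2)).
Proof.
move=> HL; under eq_Rintegral do rewrite lin_dft.
set y := wave a b (freq n k); set I := \int[P]_w _.
apply: (le_trans (ler_norm I)).
rewrite -(@ler_pXn2r _ 2) ?nnegrE ?expR_ge0// -expRM_natl real_normK ?num_real//.
have -> : 2 * - (p * L / 2) = - (p * L) by field.
apply: (le_trans (sqr_Rintegral_cos_sum_le indepX distrX y n)).
rewrite ler_expR lerN2; apply: Rintegral_ge_indic.
- apply: bounded_mfun_sum => j; apply: bounded_mfunB; first exact: bounded_mfun_cst.
  apply: bounded_mfun_cos; apply: measurable_funM; first exact: measurable_cst.
  exact: measurable_funB.
- exact: measurable_symmetrized.
- by move=> w; apply: sumr_ge0 => j _; exact: oneBcos_ge0.
move=> w /HL; congr (_ <= _); apply: eq_bigr => j _; congr (1 - cos _).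
by rewrite /y /wave; ring.
Qed.

Lemma measurable_dft_re n k : measurable_fun setT (fun w => dft_re n (X^~ w) k).
Proof. by apply: measurable_sum => j; apply: measurable_funM => //; exact: measurable_cst. Qed.

Lemma measurable_dft_im n k : measurable_fun setT (fun w => dft_im n (X^~ w) k).
Proof. by apply: measurable_sum => j; apply: measurable_funM => //; exact: measurable_cst. Qed.

Definition small_dft n k (e : R) : set T :=
  [set w | dft_re n (X^~ w) k ^+ 2 + dft_im n (X^~ w) k ^+ 2 <= e ^+ 2].

Lemma measurable_small_dft n k e : measurable (small_dft n k e).
Proof.
have m : measurable_fun setT
    (fun w => dft_re n (X^~ w) k ^+ 2 + dft_im n (X^~ w) k ^+ 2).
  apply: measurable_funD; apply: measurable_funX.
    exact: measurable_dft_re.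
  exact: measurable_dft_im.
by have := m measurableT _ (measurable_itv `]-oo, e ^+ 2]); rewrite setTI set_itvNyc.
Qed.

(** The off-diagonal error in [esseen] for a grid of mesh [eta]: distinct grid points differ by at
    least [eta], and the symmetrization scales this by at least [A]. The value 1/128 is the
    saturation level of [energy_ge]. *)
Let rate (n : nat) (eta : R) :=
  expR (- (p * (n%:R * Num.min (A ^+ 2 * eta ^+ 2 / 8) (1 / 128)) / 2)).

Let sqr_bounds x : A <= `|x| <= B -> A ^+ 2 <= x ^+ 2 <= B ^+ 2.
Proof.
move=> /andP[Ax xB]; rewrite -[x ^+ 2]real_normK ?num_real//.
by rewrite !ler_sqr ?nnegrE ?Ax ?xB// ?ltW// (le_trans (ltW A0)).
Qed.

Let small_norm (x y e : R) : 0 <= e -> x ^+ 2 + y ^+ 2 <= e ^+ 2 -> `|x| <= e /\ `|y| <= e.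
Proof.
move=> e0 H; split; rewrite -(@ler_pXn2r _ 2) ?nnegrE// real_normK ?num_real//.
  by apply: le_trans H; rewrite lerDl sqr_ge0.
by apply: le_trans H; rewrite lerDr sqr_ge0.
Qed.

(* Only the real part is used: it has enough energy at every frequency, but the
   range [eta * M] of the angles has to stay bounded. *)
Lemma small_dft_bad n k M (eta e : R) : (0 < n)%N -> (0 < M)%N -> 0 < eta -> 0 <= e ->
  eta * M%:R * B <= 1 -> eta * M%:R * e <= 1 ->
  fine (P (small_dft n k e)) <= 4 * (M%:R^-1 + rate n eta).
Proof.
move=> n0 M0 eta0 e0 HB He.
have MR : 0 < M%:R :> R by rewrite ltr0n.
have := @esseen R d T P 'I_M (fun m w => eta * m%:R * dft_re n (X^~ w) k)
  (small_dft n k e) (rate n eta).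
rewrite card_ord; apply => //.
- exact: expR_ge0.
- exact: measurable_small_dft.
- move=> m; apply: measurable_funM; first exact: measurable_cst.
  exact: measurable_dft_re.
- move=> w m /(small_norm e0)[+ _] => H; rewrite normrM.
  apply: le_trans He; rewrite ler_pM//.
  by rewrite normrM (gtr0_norm eta0) normr_nat ler_pM2l// ler_nat ltnW.
move=> m m' mm'.
under eq_Rintegral => w _.
  have -> : eta * m%:R * dft_re n (X^~ w) k - eta * m'%:R * dft_re n (X^~ w) k =
    (eta * (m%:R - m'%:R)) * dft_re n (X^~ w) k + 0 * dft_im n (X^~ w) k by ring.
  over.
apply: Rintegral_cos_dft_le => x /sqr_bounds/andP[Ax xB].
have [D1 D2] : 1 <= (m%:R - m'%:R : R) ^+ 2 /\ (m%:R - m'%:R : R) ^+ 2 <= M%:R ^+ 2.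
  by have := @sqr_ord_diff R M m m'; rewrite mm' => /andP[].
rewrite mulr0; apply: (@le_trans _ _ (n%:R * ((x * (eta * (m%:R - m'%:R))) ^+ 2 / 8))).
  rewrite ler_wpM2l// ge_min; apply/orP; left; rewrite ler_pM2r//.
  rewrite exprMn ler_pM ?sqr_ge0//.
  by rewrite exprMn ler_peMr ?sqr_ge0.
apply: energy_ge_cos; rewrite ?cos_freqn ?sin_freqn//.
have : (eta * M%:R * B) ^+ 2 <= 1.
  by rewrite expr_le1// !mulr_ge0// ltW.
rewrite !exprMn => H; apply: le_trans H; rewrite [leRHS]mulrC.
apply: ler_pM => //; first exact: sqr_ge0.
  by apply: mulr_ge0; exact: sqr_ge0.
by rewrite ler_wpM2l ?sqr_ge0.
Qed.

(** Real and imaginary parts are used together, on a grid of [M^2] points. The lower bound on the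
    order of the frequency provides the small initial shift that [energy_ge] asks for. *)
Lemma small_dft_good n k M (eta e : R) : (0 < n)%N -> (0 < M)%N -> 0 < eta -> 0 <= e ->
  (2 < freq_order n k)%N ->
  12 * (eta * M%:R * B) <= (freq_order n k)%:R -> 2 * (eta * M%:R * e) <= 1 ->
  fine (P (small_dft n k e)) <= 4 * ((M ^ 2)%N%:R^-1 + rate n eta).
Proof.
move=> n0 M0 eta0 e0 d2 HB He.
have MR : 0 < M%:R :> R by rewrite ltr0n.
have := @esseen R d T P ('I_M * 'I_M)%type (fun m w => eta * m.1%:R * dft_re n (X^~ w) k
   + eta * m.2%:R * dft_im n (X^~ w) k) (small_dft n k e) (rate n eta).
rewrite card_prod card_ord mulnn; apply => //.
- by rewrite expn_gt0 M0.
- exact: expR_ge0.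
- exact: measurable_small_dft.
- move=> m; apply: measurable_funD; apply: measurable_funM.
  + exact: measurable_cst.
  + exact: measurable_dft_re.
  + exact: measurable_cst.
  + exact: measurable_dft_im.
- move=> w [m l] /(small_norm e0)[H1 H2] /=.
  have H (i : 'I_M) (z : R) : `|z| <= e -> `|eta * i%:R * z| <= eta * M%:R * e.
    move=> ze; rewrite normrM ler_pM//.
    by rewrite normrM (gtr0_norm eta0) normr_nat ler_pM2l// ler_nat ltnW.
  apply: le_trans (ler_normD _ _) _.
  by have := H m _ H1; have := H l _ H2; lra.
move=> [m l] [m' l'] mm' /=.
under eq_Rintegral => w _.
  have -> : eta * m%:R * dft_re n (X^~ w) k + eta * l%:R * dft_im n (X^~ w) k -
      (eta * m'%:R * dft_re n (X^~ w) k + eta * l'%:R * dft_im n (X^~ w) k) =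
    (eta * (m%:R - m'%:R)) * dft_re n (X^~ w) k +
    (eta * (l%:R - l'%:R)) * dft_im n (X^~ w) k by ring.
  over.
apply: Rintegral_cos_dft_le => x /sqr_bounds/andP[Ax xB].
set u : R := m%:R - m'%:R; set v : R := l%:R - l'%:R.
have [D1 D2] : 1 <= u ^+ 2 + v ^+ 2 /\ u ^+ 2 + v ^+ 2 <= 2 * M%:R ^+ 2.
  have /andP[u1 u2] := @sqr_ord_diff R M m m'.
  have /andP[v1 v2] := @sqr_ord_diff R M l l'.
  split; last by rewrite /u /v; lra.
  suff : 1 <= (m != m')%:R + (l != l')%:R :> R by rewrite /u /v; lra.
  rewrite -natrD ler1n; move: mm'; rewrite xpair_eqE negb_and.
  by case: (m != m'); case: (l != l').
have [v2 [m0 /andP[m00 m01]]] := @freq_good R n k n0 d2.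
have E : (x * (eta * u)) ^+ 2 + (x * (eta * v)) ^+ 2 = x ^+ 2 * eta ^+ 2 * (u ^+ 2 + v ^+ 2).
  by rewrite !exprMn; ring.
apply: (@le_trans _ _ (n%:R * Num.min
    (((x * (eta * u)) ^+ 2 + (x * (eta * v)) ^+ 2) / 8) (1 / 128))).
  rewrite ler_wpM2l// le_min !ge_min lexx orbT andbT; apply/orP; left; rewrite ler_pM2r//.
  rewrite E -[leLHS]mulr1; apply: ler_pM => //; first by rewrite mulr_ge0 ?sqr_ge0.
  by rewrite ler_wpM2r ?sqr_ge0.
apply: (energy_ge _ _ v2 m00); rewrite ?cos_freqn ?sin_freqn//.
rewrite E; set D : R := (freq_order n k)%:R in HB m01 *.
have D0 : 0 < D by rewrite ltr0n (leq_trans _ d2).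
have H : (12 * (eta * M%:R * B)) ^+ 2 <= D ^+ 2.
  have P0 : 0 <= 12 * (eta * M%:R * B) by rewrite !mulr_ge0// ltW.
  by rewrite ler_sqr ?nnegrE ?(ltW D0).
have H' : x ^+ 2 * eta ^+ 2 * (u ^+ 2 + v ^+ 2) <= B ^+ 2 * eta ^+ 2 * (2 * M%:R ^+ 2).
  apply: ler_pM => //.
  - by apply: mulr_ge0; exact: sqr_ge0.
  - by apply: addr_ge0; exact: sqr_ge0.
  - by rewrite ler_wpM2r ?sqr_ge0.
apply: (@le_trans _ _ (2 * (32 / D ^+ 2) * (B ^+ 2 * eta ^+ 2 * (2 * M%:R ^+ 2)))).
  apply: ler_pM => //.
  - by rewrite -E; apply: addr_ge0; exact: sqr_ge0.
  - by rewrite ler_pM2l.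
(* The factors of 128 are the 2 in the shifted amplitude, the 32 of [freq_good] and the 2 from two
   squared coordinates; it is below the square 144 of the constant 12. *)
rewrite (_ : 2 * _ * _ = 128 * (eta * M%:R * B) ^+ 2 / D ^+ 2); last first.
  by field; rewrite gt_eqF.
rewrite ler_pdivrMr ?exprn_gt0// mul1r; apply: le_trans H.
rewrite [leRHS]exprMn ler_wpM2r ?sqr_ge0//; lra.
Qed.

Lemma smallest_singular_value_bigcup n (e : R) : (0 < n)%N -> 0 <= e ->
  [set w | smallest_singular_value (circ n (fun k => (X k w)%:C)) <= e] =
  \big[setU/set0]_(k < n) small_dft n k e.
Proof.
move=> n0 e0; apply/seteqP; split=> w /=.
  move=> /(smallest_singular_value_circ_le (X^~ w) n0 e0)[k H].
  by rewrite -bigcup_seq; exists k => //=; rewrite mem_index_enum.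
rewrite -bigcup_seq => -[k _ H].
by apply/(smallest_singular_value_circ_le (X^~ w) n0 e0); exists k.
Qed.

(** With mesh [c / q^7] and [n >= q^16] the exponent is at least [K q^2], and an exponential beats
    every power. *)
Lemma rate_le (c : R) : 0 < p -> 0 < c -> exists2 C : R, 0 <= C &
  forall n q, (0 < q)%N -> (q ^ 16 <= n)%N ->
    rate n (c / q%:R ^+ 7) <= C / q%:R ^+ 18.
Proof.
move=> p0 c0; set m := Num.min (A ^+ 2 * c ^+ 2 / 8) (1 / 128).
have m0 : 0 < m by rewrite lt_min !divr_gt0 ?mulr_gt0 ?exprn_gt0.
set K := p * m / 2; have K0 : 0 < K by rewrite divr_gt0 ?mulr_gt0.
(* From [exp (9 y) >= y^9] at [y = K q^2 / 9]. *)
exists ((9 / K) ^+ 9); first by rewrite exprn_ge0// divr_ge0// ltW.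
move=> n q q0 qn; set Q : R := q%:R.
have Q1 : 1 <= Q by rewrite ler1n.
have Q0 : 0 < Q by apply: lt_le_trans Q1.
have nQ : Q ^+ 16 <= n%:R by rewrite -natrX ler_nat.
have E14 : 0 < Q ^+ 14 by rewrite exprn_gt0.
have H1 : m / Q ^+ 14 <= Num.min (A ^+ 2 * (c / Q ^+ 7) ^+ 2 / 8) (1 / 128).
  rewrite le_min; apply/andP; split.
    rewrite (_ : A ^+ 2 * _ / 8 = A ^+ 2 * c ^+ 2 / 8 / Q ^+ 14); last first.
      by field; rewrite gt_eqF.
    by rewrite ler_pM2r ?invr_gt0// ge_min lexx.
  rewrite ler_pdivrMr//; apply: (@le_trans _ _ (1 / 128)).
    by rewrite ge_min lexx orbT.
  by rewrite ler_peMr// exprn_ege1.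
have H2 : K * Q ^+ 2 <= p * (n%:R * Num.min (A ^+ 2 * (c / Q ^+ 7) ^+ 2 / 8) (1 / 128)) / 2.
  rewrite (_ : K * Q ^+ 2 = p * (m * Q ^+ 2) / 2); last by rewrite /K; ring.
  apply: ler_wpM2r; first by rewrite invr_ge0.
  apply: ler_wpM2l; first exact: ltW.
  rewrite (_ : m * Q ^+ 2 = Q ^+ 16 * (m / Q ^+ 14)); last by field; rewrite gt_eqF.
  by apply: ler_pM => //; rewrite ?exprn_ge0 ?(ltW Q0)// divr_ge0// ltW.
rewrite /rate; apply: (@le_trans _ _ (expR (- (K * Q ^+ 2)))).
  by rewrite ler_expR lerN2.
rewrite expRN (_ : _ / Q ^+ 18 = ((K * Q ^+ 2 / 9) ^+ 9)^-1); last first.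
  by field; rewrite !gt_eqF.
have x0 : 0 < K * Q ^+ 2 / 9 by rewrite divr_gt0// mulr_gt0// exprn_gt0.
rewrite lef_pV2 ?posrE ?expR_gt0 ?exprn_gt0//.
rewrite (_ : K * Q ^+ 2 = 9%:R * (K * Q ^+ 2 / 9)) ?expRM_natl; last by field.
rewrite (_ : 9%:R * (K * Q ^+ 2 / 9) / 9 = K * Q ^+ 2 / 9); last by field.
rewrite ler_pXn2r ?nnegrE ?expR_ge0 ?(ltW x0)//.
by apply: le_trans (expR_ge1Dx _); lra.
Qed.

Lemma probability_smallest_singular_value_le (t : R) : 0 < p -> 0 < t ->
  exists2 C : R, 0 <= C & forall n q e, (1 < q)%N -> (q ^ 16 <= n < q.+1 ^ 16)%N ->
    0 <= e -> e * q%:R ^+ 8 <= t ->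
    fine (P [set w | smallest_singular_value (circ n (fun k => (X k w)%:C)) <= e])
      <= C / q%:R ^+ 2.
Proof.
(* This [c] makes both [2 c t] and [12 c B] at most 1, which covers the smallness conditions of the
   two small ball lemmas. *)
move=> p0 t0; set c := (2 * t + 12 * B)^-1.
have s0 : 0 < 2 * t + 12 * B by rewrite addr_gt0// mulr_gt0.
have c0 : 0 < c by rewrite invr_gt0.
have ct : 2 * (c * t) <= 1.
  by rewrite mulrCA mulrC ler_pdivrMr// mul1r lerDl mulr_ge0// ltW.
have cB : 12 * (c * B) <= 1.
  by rewrite mulrCA mulrC ler_pdivrMr// mul1r lerDr mulr_ge0// ltW.
have [C1 C10 HC1] := rate_le p0 c0.
(* The [2^16] comes from [n <= (2 q)^16], the 4 from the at most [4 q^4] frequencies of order at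
   most [q^2]. *)
exists (4 * (1 + C1) * (2 ^+ 16 + 4)).
  by rewrite !mulr_ge0// addr_ge0.
move=> n q e q1 /andP[qn nq] e0 et.
have q0 : (0 < q)%N by apply: ltn_trans q1.
have n0 : (0 < n)%N by apply: leq_trans qn; rewrite expn_gt0 q0.
set Q : R := q%:R in et *; set eta := c / Q ^+ 7.
have Q1 : 1 <= Q by rewrite ler1n.
have Q0 : 0 < Q by apply: lt_le_trans Q1.
have eta0 : 0 < eta by rewrite divr_gt0// exprn_gt0.
have et1 : e <= t.
  by apply: le_trans et; rewrite ler_peMr// exprn_ege1.
have r0 : rate n eta <= C1 / Q ^+ 18 by exact: HC1.
set h := 4 * (1 + C1); have h0 : 0 <= h by rewrite mulr_ge0// addr_ge0.
have term k : fine (P (small_dft n k e)) <=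
    h / Q ^+ 18 + (freq_order n k <= q ^ 2)%N%:R * (h / Q ^+ 7).
  have [kbad|kgood] := leqP (freq_order n k) (q ^ 2).
    rewrite mul1r.
    (* For low orders the angles must stay bounded: [M = q^7] gives range [c]. *)
    have M0 : (0 < q ^ 7)%N by rewrite expn_gt0 q0.
    have ME : eta * (q ^ 7)%N%:R = c.
      by rewrite natrX /eta -/Q divfK// gt_eqF// exprn_gt0.
    have := @small_dft_bad n k (q ^ 7)%N eta e n0 M0 eta0 e0.
    rewrite ME natrX -/Q => H; apply: le_trans (H _ _) _.
    - by have := mulr_ge0 (ltW c0) (ltW B0); lra.
    - have : c * e <= c * t by rewrite ler_pM2l.
      by have := mulr_ge0 (ltW c0) (ltW t0); lra.
    have i7 : 0 <= (Q ^+ 7)^-1 by rewrite invr_ge0 exprn_ge0// ltW.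
    have i18 : 0 <= (Q ^+ 18)^-1 by rewrite invr_ge0 exprn_ge0// ltW.
    by rewrite /h; nra.
  rewrite mul0r addr0.
  (* For orders above [q^2] the range may grow to [c q^2]: [M = q^9], so the main term is
     [q^(-18)]. *)
  have M0 : (0 < q ^ 9)%N by rewrite expn_gt0 q0.
  have ME : eta * (q ^ 9)%N%:R = c * Q ^+ 2.
    by rewrite natrX /eta -/Q; field; rewrite gt_eqF.
  have := @small_dft_good n k (q ^ 9)%N eta e n0 M0 eta0 e0.
  rewrite ME -expnM natrX -/Q => H; apply: le_trans (H _ _ _) _.
  - by apply: leq_ltn_trans kgood; rewrite (leq_trans q1)// -[leqLHS]expn1 leq_pexp2l.
  - apply: (@le_trans _ _ (Q ^+ 2)); last by rewrite -natrX ler_nat ltnW.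
    by have Q2 := sqr_ge0 Q; nra.
  - have : e * Q ^+ 2 <= t.
      by apply: le_trans et; rewrite ler_wpM2l// ler_weXn2l.
    by rewrite -(ler_pM2l c0); lra.
  rewrite /h; have i18 : 0 <= (Q ^+ 18)^-1 by rewrite invr_ge0 exprn_ge0// ltW.
  by nra.
have mS k : measurable (small_dft n k e) by exact: measurable_small_dft.
rewrite smallest_singular_value_bigcup//.
apply: (@le_trans _ _ (\sum_(k < n) fine (P (small_dft n k e)))).
  rewrite -lee_fin fineK ?fin_num_measure//; last exact: bigsetU_measurable.
  rewrite -sumEFin; under [leRHS]eq_bigr do rewrite fineK ?fin_num_measure//.
  have := @Boole_inequality _ _ _ P (fun k => small_dft n k e) n (fun k _ => mS k).
  exact.
apply: (@le_trans _ _ (\sum_(k < n) (h / Q ^+ 18 +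
    (freq_order n k <= q ^ 2)%N%:R * (h / Q ^+ 7)))).
  by apply: ler_sum => k _; exact: term.
rewrite big_split/= sumr_const card_ord -mulr_suml -[X in X + _]mulr_natl.
have nb : \sum_(k < n) (freq_order n k <= q ^ 2)%N%:R <= 4 * Q ^+ 4 :> R.
  rewrite -natr_sum (_ : (\sum_(k < n) _)%N = #|[set k : 'I_n | (freq_order n k <= q ^ 2)%N]%SET|).
    rewrite (_ : 4 * Q ^+ 4 = (2 * q ^ 2)%N%:R ^+ 2); last by rewrite natrM natrX -/Q; ring.
    rewrite -natrX ler_nat (leq_trans (card_freq_bad _ _))// leq_exp2r//.
    by rewrite mul2n -addnn -[leqLHS]addn1 leq_add2l expn_gt0 q0.
  by rewrite -sum1dep_card [RHS]big_mkcond; apply: eq_bigr => k _; case: ifP.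
have nn : n%:R <= 2 ^+ 16 * Q ^+ 16.
  rewrite -exprMn -natrM -natrX ler_nat (leq_trans (ltnW nq))// leq_exp2r//.
  by rewrite mul2n -addnn -[leqLHS]addn1 leq_add2l.
apply: (@le_trans _ _ (2 ^+ 16 * Q ^+ 16 * (h / Q ^+ 18) + 4 * Q ^+ 4 * (h / Q ^+ 7))).
  by apply: lerD; rewrite ler_wpM2r// divr_ge0// exprn_ge0// ltW.
(* The low orders contribute [q^4 q^(-7)], one power of [q] less than the target [q^(-2)]. *)
rewrite -subr_ge0 (_ : _ - _ = 4 * h / Q ^+ 2 * (1 - Q^-1)).
  apply: mulr_ge0; last by rewrite subr_ge0 invf_le1.
  by apply: divr_ge0; [exact: mulr_ge0|exact: sqr_ge0].
by field; rewrite gt_eqF.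
Qed.

End dft_small_ball.

(** * Powers of the logarithm against powers of [q] *)

Section logarithmic_growth.
Context {R : realType}.

(** This is [ln y <= y] at [y = x / (8 b)]. At [x = ln n] the exponential is [n^(1/8)], which is of
    order [q^2]. *)
Lemma powR_le_expR (b : R) : 0 < b ->
  exists2 C : R, 0 < C & forall x, 0 < x -> x `^ b <= C * expR (x / 8).
Proof.
move=> b0; set K := 8 * b; have K0 : 0 < K by rewrite mulr_gt0.
exists (expR (b * ln K)); first exact: expR_gt0.
move=> x x0; rewrite /powR gt_eqF// -expRD ler_expR.
have xK0 : 0 < x / K by rewrite divr_gt0.
have -> : ln x = ln (x / K) + ln K by rewrite -lnM ?posrE// divfK// gt_eqF.
have -> : x / 8 = b * (x / K) by rewrite /K; field; rewrite gt_eqF.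
rewrite mulrDr addrC lerD2l ler_wpM2l// ?(ltW b0)//.
by apply: ltW; exact: ln_sublinear.
Qed.

Lemma exists_root16 n : (2 ^ 16 <= n)%N ->
  exists2 q, (1 < q)%N & (q ^ 16 <= n < q.+1 ^ 16)%N.
Proof.
move=> n2; have ex : exists q, (q ^ 16 <= n)%N by exists 2%N.
have bd q : (q ^ 16 <= n)%N -> (q <= n)%N.
  by apply: leq_trans; case: q => // q; rewrite -[leqLHS]expn1 leq_pexp2l.
case: (ex_maxnP ex bd) => q qn qmax; exists q; first exact: qmax.
rewrite qn ltnNge; apply/negP => /qmax; by rewrite ltnn.
Qed.

Lemma powR_ln_le (b : R) : 0 < b -> exists2 C : R, 0 < C &
  forall n q, (1 < n)%N -> (0 < q)%N -> (n < q.+1 ^ 16)%N ->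
    (ln n%:R : R) `^ b <= C * q%:R ^+ 2.
Proof.
move=> b0; have [C C0 HC] := powR_le_expR b0.
exists (4 * C); first by rewrite mulr_gt0.
move=> n q n1 q0 nq; have nR : 1 < n%:R :> R by rewrite ltr1n.
have n0 : 0 < n%:R :> R by apply: lt_trans nR.
apply: le_trans (HC _ _) _; first by rewrite ln_gt0.
rewrite -mulrA mulrCA ler_pM2l//.
rewrite (_ : 4 * q%:R ^+ 2 = (2 * q%:R) ^+ 2); last by ring.
rewrite -(@ler_pXn2r _ 8) ?nnegrE ?expR_ge0 ?exprn_ge0 ?mulr_ge0//.
rewrite -expRM_natl (_ : 8%:R * (ln n%:R / 8) = ln n%:R); last by field.
rewrite lnK ?posrE// -exprM -natrM -natrX ler_nat (leq_trans (ltnW nq))//.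
by rewrite leq_exp2r// mul2n -addnn -[leqLHS]addn1 leq_add2l.
Qed.

End logarithmic_growth.

Theorem corollary2p5 (R : realType)
  (d0 : measure_display) (T0 : measurableType d0) (P0 : probability T0 R)
  (xi : {RV P0 >-> R})
  (xi_mean : ('E_P0[xi] = 0)%E)
  (xi_var : (0 < 'V_P0[xi] < +oo)%E)
  (xi_mgf : mgf_finite_near0 xi)
  (d : measure_display) (T : measurableType d) (P : probability T R)
  (xi_ : nat -> {RV P >-> R})
  (xi_indep : mutually_independent xi_)
  (xi_distr : forall k : nat, equal_in_distribution (xi_ k) xi)
  (t gamma : R) (t_ge1 : 1 <= t) (gamma_gt : 2^-1 < gamma) :
  (fun n : nat =>
     fine (P [set w | smallest_singular_value
                        (circ n (fun k => (xi_ k w)%:C)) <=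
                      t * n%:R `^ (- 2^-1) * (ln n%:R) `^ (- gamma)]))
  =O_\oo (fun n : nat => (ln n%:R : R) `^ (- gamma + 2^-1)).

Proof.
have t0 : 0 < t by apply: lt_le_trans t_ge1.
have [A [B [A0 B0 p0]]] :=
  exists_symmetrized_bulk xi_indep xi_distr xi_mean (andP xi_var).1.
have distr0 k : equal_in_distribution (xi_ k) (xi_ 0%N).
  by move=> D mD; rewrite (xi_distr k)// -(xi_distr 0%N).
have p0' : 0 < fine (P [set w | A <= `|xi_ 0%N w - xi_ 1%N w| <= B]).
  by rewrite fine_gt0// p0/= ltey_eq fin_num_measure//; exact: measurable_symmetrized.
have [C C0 HC] := probability_smallest_singular_value_le xi_indep distr0 A0 B0 p0' t0.
have b0 : 0 < gamma - 2^-1 by rewrite subr_gt0.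
have [D D0 HD] := powR_ln_le b0.
(* The added 1 only makes the constant positive when [C] is 0. *)
apply/eqO_exP; exists (C * D + 1); first by rewrite ltr_wpDl// mulr_ge0// ltW.
near=> n.
have n16 : (2 ^ 16 <= n)%N by near: n; exact: nbhs_infty_ge.
have n1 : (1 < n)%N by apply: leq_trans n16.
have [q q1 qn] := exists_root16 n16.
have ln1 : 1 <= ln n%:R :> R.
  rewrite -ler_expR lnK ?posrE ?ltr0n ?(ltnW n1)//.
  near: n; exact: nbhs_infty_ger.
set e := t * _ * _.
have e0 : 0 <= e by rewrite !mulr_ge0 ?powR_ge0// ltW.
have Q0 : 0 < q%:R :> R by rewrite ltr0n ltnW.
(* Indeed [q^8] is at most the square root of [n], and the logarithmic factor is at most 1 because
   [ln n >= 1]. *)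
have eQ : e * q%:R ^+ 8 <= t.
  have g1 : ln n%:R `^ (- gamma) <= 1 :> R.
    rewrite powRN invf_le1 ?powR_gt0 ?(lt_le_trans _ ln1)//.
    rewrite -[leLHS](powRr0 (ln n%:R)) ler_powR//.
    by apply: ltW; apply: lt_trans gamma_gt; rewrite invr_gt0.
  have g2 : n%:R `^ (- 2^-1) * q%:R ^+ 8 <= 1 :> R.
    rewrite powRN powR12_sqrt// ler_pdivrMl ?mulr1 ?sqrtr_gt0 ?ltr0n ?(ltnW n1)//.
    rewrite -(ger0_norm (exprn_ge0 8 (ltW Q0))) -sqrtr_sqr ler_sqrt//.
    by rewrite -exprM -natrX ler_nat; case/andP: qn.
  rewrite (_ : e * _ = t * (n%:R `^ (- 2^-1) * q%:R ^+ 8 * ln n%:R `^ (- gamma))); last first.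
    by rewrite /e; ring.
  rewrite ler_piMr ?(ltW t0)//; apply: mulr_ile1 => //; last exact: powR_ge0.
have l0 : 0 < ln n%:R `^ (gamma - 2^-1) :> R.
  by rewrite powR_gt0// (lt_le_trans _ ln1).
rewrite ger0_norm ?fine_ge0 ?measure_ge0// ger0_norm ?powR_ge0//.
apply: le_trans (HC n q e q1 qn e0 eQ) _.
(* What remains is to absorb [(ln n)^(gamma - 1/2)] into [D q^2], which cancels the decay
   [q^(-2)]. *)
rewrite (_ : - gamma + 2^-1 = - (gamma - 2^-1)); last by ring.
rewrite powRN ler_pdivlMr//.
have /andP[_ nq] := qn.
have H := HD n q n1 (ltnW q1) nq.
apply: (@le_trans _ _ (C / q%:R ^+ 2 * (D * q%:R ^+ 2))).
  by rewrite ler_wpM2l// divr_ge0// exprn_ge0// ltW.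
rewrite (_ : _ * _ = C * D); first by rewrite lerDl.
by field; rewrite gt_eqF.
Unshelve. all: by end_near.
Qed.
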